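(* For every $0<\delta<1$ there is a constant $C_\delta>0$, depending only on $\delta$, such that the following holds. Let $n,N,m,r$ be natural numbers with $1\le r\le n$, let $0<\varepsilon<1$, and let $\mathcal{X}:\mathbb{R}^{n\times N}\to\mathbb{R}^m$ be a Gaussian information map. If $$m\ge C_\delta\bigl(r(n+N)+\ln(2/\varepsilon)\bigr),$$ then with probability at least $1-\varepsilon$ the map $\mathcal{X}$ has rank-$r$ restricted isometry constant $\delta_r\le\delta$, i.e. $$(1-\delta)\|A\|_F^2\le\|\mathcal{X}(A)\|_2^2\le(1+\delta)\|A\|_F^2$$ holds simultaneously for all matrices $A\in\mathbb{R}^{n\times N}$ of rank at most $r$.
   Context: $\langle A,B\rangle_F=\sum_{k,l}A_{k,l}B_{k,l}$ is the Frobenius inner product and $\|\cdot\|_F$ the Frobenius norm. A Gaussian information map is the random linear map $\mathcal{X}(A)=(\langle X_j,A\rangle_F)_{j=1}^m\in\mathbb{R}^m$, where $X_1,\dots,X_m\in\mathbb{R}^{n\times N}$ are random matrices whose entries $(X_j)_{k,l}=\frac{1}{\sqrt m}\,\omega_{j,k,l}$, with $\omega_{j,k,l}$ ($1\le j\le m$, $1\le k\le n$, $1\le l\le N$) independent standard normal random variables. *)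

(* Defs.v *)
From HB Require Import structures.
From mathcomp Require Import all_boot all_order all_algebra.
From mathcomp Require Import all_classical all_reals all_analysis.

Set Implicit Arguments.
Unset Strict Implicit.
Unset Printing Implicit Defensive.

Import Order.TTheory GRing.Theory Num.Theory.
Import numFieldNormedType.Exports.

Local Open Scope classical_set_scope.
Local Open Scope ring_scope.

(* The library norm [`|A|] on matrices is the sup norm, hence the explicit
   Frobenius and Euclidean norms. *)

Definition frob_dot (R : realType) (n N : nat) (A B : 'M[R]_(n, N)) : R :=
  \sum_(k < n) \sum_(l < N) A k l * B k l.

Definition frob_norm (R : realType) (n N : nat) (A : 'M[R]_(n, N)) : R :=
  Num.sqrt (frob_dot A A).

Definition l2_norm (R : realType) (m : nat) (x : 'rV[R]_m) : R :=
  Num.sqrt (\sum_(j < m) x 0 j ^+ 2).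

Definition mutually_independent (R : realType) (d : measure_display)
    (T : measurableType d) (P : probability T R) (I : finType)
    (X : I -> {RV P >-> R}) : Prop :=
  forall (J : {set I}) (B : I -> set R), (forall i, measurable (B i)) ->
    P [set w | forall i, i \in J -> B i (X i w)] =
    (\prod_(i in J) P (X i @^-1` B i))%E.

(* [normal_prob] is an integral, so the two set functions are only compared
   on Borel sets. *)
Definition standard_normal (R : realType) (d : measure_display)
    (T : measurableType d) (P : probability T R) (X : {RV P >-> R}) : Prop :=
  forall B : set R, measurable B -> distribution P X B = normal_prob 0 1 B.

Definition gaussian_information_map (R : realType) (d : measure_display)
    (T : measurableType d) (P : probability T R) (n N m : nat)
    (X : T -> 'M[R]_(n, N) -> 'rV[R]_m) : Prop :=
  exists omega : 'I_m * 'I_n * 'I_N -> {RV P >-> R},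
    [/\ mutually_independent omega,
        forall i, standard_normal (omega i) &
        forall (w : T) (A : 'M[R]_(n, N)),
          X w A = \row_(j < m) frob_dot
            (\matrix_(k < n, l < N) ((Num.sqrt m%:R)^-1 * omega (j, k, l) w))
            A].

Definition rank_rip (R : realType) (n N m : nat) (r : nat)
    (X : 'M[R]_(n, N) -> 'rV[R]_m) (delta : R) : Prop :=
  forall A : 'M[R]_(n, N), (\rank A <= r)%N ->
    (1 - delta) * frob_norm A ^+ 2 <= l2_norm (X A) ^+ 2 /\
    l2_norm (X A) ^+ 2 <= (1 + delta) * frob_norm A ^+ 2.

(* The smallest admissible constant.  For linear [X] the set is nonempty and
   closed, so the infimum is attained; [0 <= delta] is automatic as soon as
   there is a nonzero matrix of rank at most [r]. *)
Definition rank_ric (R : realType) (n N m : nat) (r : nat)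
    (X : 'M[R]_(n, N) -> 'rV[R]_m) : R :=
  inf [set delta : R | 0 <= delta /\ rank_rip r X delta].

(* Main.v *)
(** Write a rank-[r] matrix as [A = V *m U] with [U] a contraction acting on the
    right and [frob_norm V <= frob_norm A].  For any norm on [p x q] matrices the
    unit ball has a net of size [kappa ^ (p * q)]: a maximal separated set of
    integer points in a large ball is controlled by comparing the numbers of
    integer points in balls of radii [k * t] and [t], via congruence modulo [2k].
    Nets for the [V]'s (Frobenius norm) and for the [U]'s (operator norm) have
    [kappa ^ (r * (n + N))] pairs, and the distortion of products on the net
    controls that of all rank-[r] matrices, because [A - V' *m U'] is a sum of two
    small matrices of rank at most [r].

    For a fixed unit matrix, [m * l2_norm (X A) ^+ 2] is a sum of squares of [m]
    independent variables [g] with [E exp (lam * g) = exp (lam ^ 2 / 2)].  Comparing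
    [exp (+- s * g ^ 2)] with [cosh (sqrt s * g)] gives
    [E exp (+- s * g ^ 2) <= exp (+- s + C * s ^ 2)], hence a Chernoff bound
    [2 * exp (- c * m)], and a union bound over the net concludes. *)

Require Import Defs.
From HB Require Import structures.
From mathcomp Require Import all_boot all_order all_algebra.
From mathcomp Require Import all_classical all_reals all_analysis.
From mathcomp Require Import measurable_realfun.
From mathcomp Require Import ring lra.

Import Order.TTheory GRing.Theory Num.Theory.
Import numFieldNormedType.Exports.

Local Open Scope classical_set_scope.
Local Open Scope ring_scope.

Set Implicit Arguments.
Unset Strict Implicit.

(** * Independence and integration *)

(** Two difficulties do not show in the estimate itself. The good event is an intersection over
    uncountably many matrices, so its measurability needs an argument: near-isometry is homogeneous
    and closed, and matrices [c *: (Z1 *m Z2)] with integer factors are dense among those of rank at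
    most [r], which leaves a countable intersection. Independence is given only on Borel rectangles;
    it has to be extended to expectations of products and to linear combinations of disjoint groups.
    The law of a normalised combination of Gaussian entries is never identified: concentration uses
    only its moment generating function, whence the comparison with [cosh]. Lattice points replace
    the usual volume argument, so no measure on matrix spaces is involved. The net argument is
    self-bounding: the supremum [K] of the measured norm over the low-rank unit ball satisfies
    [K <= a + 3 * rho * K], and it is finite beforehand because the map is bounded for each fixed
    sample. *)

Section WeightedLaw.
Local Open Scope ereal_scope.
Context (R : realType).

Import HBNNSimple.

(** Monotone convergence along simple functions. Approximating [f] on [Y], and not [f \o X] on [T],
    makes the right-hand side depend on [mu], [G] and [X] only through the weighted law of [X]. *)
Lemma integral_weight_comp_approx d d' (T : measurableType d)
    (Y : measurableType d') (mu : {measure set T -> \bar R})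
    (G : T -> R) (X : T -> Y) (f : Y -> R)
    (mf : measurable_fun [set: Y] (EFin \o f)) :
  (forall x, 0 <= G x)%R -> measurable_fun setT G -> measurable_fun setT X ->
  (forall y, 0 <= f y)%R ->
  \int[mu]_x (G x * f (X x))%:E =
  limn (fun n => \sum_(k \in range (nnsfun_approx measurableT mf n))
    (k%:E * \int[mu]_x (G x *
      (\1_(nnsfun_approx measurableT mf n @^-1` [set k]) (X x)))%:E)).
Proof.
move=> G0 mG mX f0.
set g := nnsfun_approx measurableT mf.
have mgX n : measurable_fun setT (fun x => g n (X x)).
  by apply: measurableT_comp.
transitivity (limn (fun n => \int[mu]_x (G x * g n (X x))%:E)).
  rewrite -monotone_convergence//.
  - apply: eq_integral => x _; apply/esym/cvg_lim => //.
    rewrite EFinM; under eq_fun do rewrite EFinM.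
    by apply: cvgeZl => //; apply: cvg_nnsfun_approx => // y _; exact: f0.
  - by move=> n; apply/measurable_EFinP; exact: measurable_funM.
  - by move=> n x _; rewrite lee_fin mulr_ge0.
  - move=> x _ m n mn; rewrite lee_fin ler_wpM2l//.
    exact/lefP/nd_nnsfun_approx.
apply: congr_lim; apply/funext => n.
have mI k : measurable_fun setT (fun x => (G x * \1_(g n @^-1` [set k]) (X x))%R).
  apply: measurable_funM => //; apply: (measurableT_comp _ mX).
  exact: measurable_indic.
transitivity (\int[mu]_x (\sum_(k \in range (g n))
    (k * (G x * \1_(g n @^-1` [set k]) (X x)))%:E)).
  apply: eq_integral => x _; rewrite fsumEFin//; congr EFin.
  rewrite {1}(fimfunE (g n)) mulr_fsumr //.
  by apply: eq_fsbigr => k _; rewrite mulrCA.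
have gE (k : R) (x : T) : (g n @^-1` [set k]) (X x) -> (0 <= k)%R by move=> <-.
have k0 (k : R) x : (0 <= k * (G x * \1_(g n @^-1` [set k]) (X x)))%R.
  rewrite indicE; case: (boolP (X x \in _)) => [|_]; last by rewrite !mulr0.
  by rewrite inE => /gE ?; rewrite mulr1 mulr_ge0.
rewrite ge0_integral_fsum//; last 2 first.
  - by move=> k; apply/measurable_EFinP; exact: measurable_funM.
  - by move=> k x _; rewrite lee_fin.
apply: eq_fsbigr => k; rewrite inE/= => -[y _ <-].
under eq_integral do rewrite EFinM.
rewrite ge0_integralZl_EFin//.
- by move=> x _; rewrite lee_fin mulr_ge0// indicE.
- exact/measurable_EFinP.
Qed.

(** A weighted law determines all integrals of nonnegative functions. The weight will be a normal
    density, the product of the other independent factors, or the constant one when a law is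
    transported. *)
Lemma eq_integral_weight_comp d1 d2 d' (T1 : measurableType d1)
    (T2 : measurableType d2) (Y : measurableType d')
    (mu1 : {measure set T1 -> \bar R}) (mu2 : {measure set T2 -> \bar R})
    (G1 : T1 -> R) (G2 : T2 -> R) (X1 : T1 -> Y) (X2 : T2 -> Y) :
  (forall x, 0 <= G1 x)%R -> measurable_fun setT G1 -> measurable_fun setT X1 ->
  (forall x, 0 <= G2 x)%R -> measurable_fun setT G2 -> measurable_fun setT X2 ->
  (forall B, measurable B -> \int[mu1]_x (G1 x * \1_B (X1 x))%:E =
                             \int[mu2]_x (G2 x * \1_B (X2 x))%:E) ->
  forall f : Y -> R, measurable_fun setT f -> (forall y, 0 <= f y)%R ->
  \int[mu1]_x (G1 x * f (X1 x))%:E = \int[mu2]_x (G2 x * f (X2 x))%:E.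
Proof.
move=> G10 mG1 mX1 G20 mG2 mX2 eqB f mf f0.
have mEf : measurable_fun [set: Y] (EFin \o f) by exact/measurable_EFinP.
rewrite !(integral_weight_comp_approx _ mEf)//.
apply: congr_lim; apply/funext => n; apply: eq_fsbigr => k _.
by rewrite eqB.
Qed.

End WeightedLaw.

(** * Independence of generated sigma-algebras and expectations of products *)

Section IndependentSigmaAlgebras.
Local Open Scope ereal_scope.
Context d (T : measurableType d) (R : realType) (P : probability T R)
  (I : finType).

Lemma bigcap_finType_D1 (D : I -> set T) (i : I) :
  \bigcap_j D j = D i `&` \bigcap_(j in [set j | j != i]) D j.
Proof.
apply/seteqP; split=> [x Dx|x [Dix Dx] j _]; first by split=> [|j _]; exact: Dx.
by have [->//|ji] := eqVneq j i; exact: Dx.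
Qed.

Lemma bigcap_finType_measurable (D : I -> set T) (Q : set I) :
  (forall i, measurable (D i)) -> measurable (\bigcap_(i in Q) D i).
Proof. by move=> mD; apply: fin_bigcap_measurable. Qed.

(** The indices are upgraded from [G i] to [<<s G i>>] one at a time. With the other events fixed,
    [P] restricted to their intersection and [P] scaled by the product of their probabilities are
    finite measures that agree on the intersection-stable family [G i], hence on what it
    generates. *)
Lemma independent_sigma_algebras (G : I -> set (set T)) :
  (forall i, G i `<=` measurable) -> (forall i, setI_closed (G i)) ->
  (forall i, G i setT) ->
  (forall D, (forall i, G i (D i)) -> P (\bigcap_i D i) = \prod_i P (D i)) ->
  forall D, (forall i, <<s G i >> (D i)) -> P (\bigcap_i D i) = \prod_i P (D i).
Proof.
move=> Gm GI GT indep D sD.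
have sGm i : <<s G i >> `<=` measurable.
  by apply: smallest_sub => //; exact: sigma_algebra_measurable.
suff H : forall s : seq I, forall D, (forall i, i \in s -> <<s G i >> (D i)) ->
    (forall i, i \notin s -> G i (D i)) ->
    P (\bigcap_i D i) = \prod_i P (D i).
  by apply: (H (enum I)) => i; rewrite ?mem_enum.
elim=> [{sD}D _ GD|i s IHs {sD}D sD GD]; first by apply: indep => i; exact: GD.
have [si|si] := boolP (i \in s).
  apply: IHs => j js; first by apply: sD; rewrite inE js orbT.
  apply: GD; rewrite inE (negbTE js) orbF; apply: contraNneq js => ->//.
have mD j : measurable (D j).
  apply: (sGm j); have [/sD//|/GD] := boolP (j \in i :: s).
  exact: sub_gen_smallest.
pose E := \bigcap_(j in [set j | j != i]) D j.
have mE : measurable E by exact: bigcap_finType_measurable.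
have fin_c : \prod_(j | j != i) P (D j) \is a fin_num.
  by apply: prode_fin_num => j _; exact: fin_num_measure.
have c_ge0 : (0 <= fine (\prod_(j | j != i) P (D j)))%R.
  by rewrite fine_ge0// prode_ge0.
rewrite (bigcap_finType_D1 _ i) -/E (bigD1 i)//= -(fineK fin_c) muleC.
have cov : \bigcup_(k : nat) [set: T] = setT by rewrite bigcup_const.
have sDi := sD i (mem_head _ _).
apply: (@g_sigma_algebra_measure_unique _ R T (G i) (Gm i) (fun=> setT)
  (fun=> GT i) cov (mrestr P mE) (mscale (NngNum c_ge0) P) (GI i) _ _ _ sDi).
- move=> A GA; transitivity (\prod_(j | j != i) P (D j) * P A); last first.
    by rewrite -{1}(fineK fin_c).
  rewrite /mrestr [RHS]muleC.
  have := IHs (fun j => if j == i then A else D j).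
  rewrite (bigcap_finType_D1 _ i) eqxx (bigD1 i)//= eqxx.
  rewrite (_ : \bigcap_(j in [set j | j != i]) _ = E); last first.
    by apply: eq_bigcapr => j /= /negbTE ->.
  under eq_bigr do rewrite ifN//.
  apply=> j js.
    by rewrite ifN; [apply: sD; rewrite inE js orbT|apply: contraNneq si => <-].
  by case: eqVneq => [->//|ji]; apply: GD; rewrite inE negb_or ji.
- move=> k; change (P (setT `&` E) < +oo); rewrite setTI.
  by rewrite (le_lt_trans (probability_le1 P mE))// ltry.
Qed.

(** Indicators are exchanged for the functions [f i] one index at a time. When index [i] is treated,
    the product of the other factors is a weight, and comparing weighted laws reduces [f i] to
    indicators, where the induction hypothesis applies. Finite expectations make the remaining
    product a real scalar. *)
Lemma integral_prod_independent (X : I -> T -> R) (f : I -> R -> R) :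
  (forall i, measurable_fun setT (X i)) ->
  (forall B : I -> set R, (forall i, measurable (B i)) ->
    P (\bigcap_i (X i @^-1` B i)) = \prod_i P (X i @^-1` B i)) ->
  (forall i, measurable_fun setT (f i)) -> (forall i x, 0 <= f i x)%R ->
  (forall i, \int[P]_w (f i (X i w))%:E < +oo) ->
  \int[P]_w (\prod_i f i (X i w))%:E = \prod_i \int[P]_w (f i (X i w))%:E.
Proof.
move=> mX indep mf f0 fy.
have mXB i B : measurable B -> measurable (X i @^-1` B).
  by move=> mB; rewrite -[_ @^-1` _]setTI; exact: mX.
(* Mixed family: indices in [s] already carry [f i], the others still carry an indicator. *)
pose g (s : seq I) (B : I -> set R) i : R -> R := if i \in s then f i else \1_(B i).
have int_indic i A : measurable A ->
    \int[P]_w (\1_A (X i w))%:E = P (X i @^-1` A).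
  by move=> mA; rewrite -[in RHS](setIT (_ @^-1` _)) -integral_indic//; exact: mXB.
suff H (s : seq I) B : (forall i, measurable (B i)) ->
    \int[P]_w (\prod_i g s B i (X i w))%:E =
    \prod_i \int[P]_w (g s B i (X i w))%:E.
  move: (H (enum I) (fun=> setT) (fun=> measurableT)); rewrite /g.
  under eq_integral do under eq_bigr do rewrite mem_enum/=.
  move=> ->; apply: eq_bigr => i _; rewrite mem_enum//.
elim: s B => [|i s IHs] B mB.
  transitivity (P (\bigcap_i (X i @^-1` B i))).
    rewrite -(setIT (\bigcap_i _)) -integral_indic//; last first.
      by apply: bigcap_finType_measurable => i; exact: mXB.
    apply: eq_integral => w _; congr EFin; rewrite /g/= indicE.
    case: (boolP (w \in _)) => [|/negP wB].
      rewrite inE => wB; rewrite big1// => i _.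
      by rewrite indicE mem_set//; exact: wB.
    apply/eqP; apply/prodf_eq0; apply: contra_notP wB => nB.
    rewrite inE => i _; apply: contra_notP nB => nBi; exists i => //.
    by rewrite indicE memNset.
  by rewrite indep//; apply: eq_bigr => i _; rewrite /g/= int_indic.
have mg s' B' j : (forall i, measurable (B' i)) ->
    measurable_fun setT (g s' B' j).
  by move=> mB'; rewrite /g; case: ifP => // _; exact: measurable_indic.
have g0 s' B' j x : (0 <= g s' B' j x)%R.
  by rewrite /g; case: ifP => // _; rewrite indicE.
have gy s' B' j : (forall i, measurable (B' i)) ->
    \int[P]_w (g s' B' j (X j w))%:E \is a fin_num.
  move=> mB'; rewrite ge0_fin_numE; last by apply: integral_ge0 => w _; rewrite lee_fin.
  rewrite /g; case: ifP => // _; rewrite int_indic//.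
  by rewrite (le_lt_trans (probability_le1 _ _)) ?ltry//; exact: mXB.
have [si|si] := boolP (i \in s).
  have -> : g (i :: s) B = g s B.
    apply/funext => j; rewrite /g inE; case: eqVneq => [->|//].
    by rewrite si.
  exact: IHs.
have giE : g (i :: s) B i = f i by rewrite /g inE eqxx.
have gsE j : j != i -> g (i :: s) B j = g s B j.
  by move=> ji; rewrite /g inE (negbTE ji).
rewrite [RHS](bigD1 i)//=.
under eq_bigr => j ji do rewrite gsE//.
under eq_integral => w _.
  rewrite (bigD1 i)//=; under eq_bigr => j ji do rewrite gsE//.
  rewrite giE mulrC; over.
rewrite /= giE.
set c := \prod_(j | j != i) _.
have c0 : 0 <= c by apply: prode_ge0 => j _; apply: integral_ge0 => w _; rewrite lee_fin.
have cfin : c \is a fin_num by apply: prode_fin_num => j _; exact: gy.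
have mfX : measurable_fun setT (fun w => f i (X i w)) by apply: measurableT_comp.
transitivity (\int[P]_w (fine c * f i (X i w))%:E); last first.
  under eq_integral do rewrite EFinM.
  rewrite ge0_integralZl_EFin ?fineK ?fine_ge0 1?muleC//.
    by move=> w _; rewrite lee_fin.
  exact/measurable_EFinP.
apply: (eq_integral_weight_comp (X1 := X i) (X2 := X i)) => //.
- by move=> w; apply: prodr_ge0.
- rewrite (_ : (fun w => _) = fun w =>
      \prod_(j <- [seq j <- index_enum I | j != i]) g s B j (X j w))%R.
    apply: measurable_prod => j _; apply: measurableT_comp => //; exact: mg.
  by apply/funext => w; rewrite big_filter.
- by move=> ?; rewrite fine_ge0.
move=> A mA; pose B' j := if j == i then A else B j.
have mB' j : measurable (B' j) by rewrite /B'; case: ifP.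
have gB'i : g s B' i = \1_A by rewrite /g (negbTE si) /B' eqxx.
have gB'j j : j != i -> g s B' j = g s B j.
  by move=> ji; rewrite /g /B' (negbTE ji).
transitivity (\int[P]_w (\prod_j g s B' j (X j w))%:E).
  apply: eq_integral => w _; rewrite [in RHS](bigD1 i)//= gB'i mulrC.
  by congr (_ * _)%:E; apply: eq_bigr => j ji; rewrite gB'j.
rewrite IHs// (bigD1 i)//= gB'i.
under eq_bigr => j ji do rewrite gB'j//.
rewrite -/c; under [RHS]eq_integral do rewrite EFinM.
rewrite [RHS]ge0_integralZl_EFin.
- by rewrite fineK// muleC.
- exact: measurableT.
- by move=> w _; rewrite lee_fin indicE.
- apply/measurable_EFinP; apply: (measurableT_comp _ (mX i)).
  exact: measurable_indic.
- exact: fine_ge0.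
Qed.

End IndependentSigmaAlgebras.

(** * Gaussian concentration *)

Section ExpBounds.
Context (R : realType).
Implicit Types x s y : R.

(** The tail terms satisfy [|x|^(k+4) / (k+4)! <= x^4 * |x|^k / k!]. Order three is the useful one:
    adding the expansions at [u] and [-u] cancels the odd terms and leaves an error of order [u^4],
    that is [s^2] for [u = sqrt s * x]. *)
Lemma expR_taylor3 x :
  `|expR x - (1 + x + x ^+ 2 / 2 + x ^+ 3 / 6)| <= x ^+ 4 * expR `|x|.
Proof.
set M := x ^+ 4 * _; set p := 1 + _ + _ + _.
have bnd n : `|series (exp_coeff x) (n + 4)%N - p| <= M.
  have -> : series (exp_coeff x) (n + 4)%N - p = \sum_(k < n) exp_coeff x (k + 4)%N.
    have p4 : \sum_(0 <= k < 4) exp_coeff x k = p.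
      rewrite !big_nat_recr//= big_geq// /p /exp_coeff/= !factS fact0.
      by rewrite !mulnE/=; lra.
    rewrite /series/= (@big_cat_nat _ _ _ 4)//= ?leq_addl// p4 [p + _]addrC addrK.
    by rewrite -{1}[4%N]add0n big_addn addnK big_mkord.
  apply: (le_trans (ler_norm_sum _ _ _)).
  apply: (@le_trans _ _ (\sum_(k < n) x ^+ 4 * exp_coeff `|x| k)).
    apply: ler_sum => k _; rewrite /exp_coeff/= normrM normrX exprD -[`|x| ^+ 4]normrX.
    have x4 : `|x ^+ 4| = x ^+ 4 by rewrite ger0_norm// exprn_even_ge0.
    have kf : `|(k + 4)`!%:R^-1| = (k + 4)`!%:R^-1 :> R by rewrite ger0_norm.
    rewrite x4 kf [leRHS]mulrA [x ^+ 4 * _]mulrC.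
    apply: ler_wpM2l; first by apply: mulr_ge0; [exact: exprn_ge0|exact: exprn_even_ge0].
    by rewrite lef_pV2 ?posrE ?ltr0n ?fact_gt0// ler_nat leq_fact// leq_addr.
  rewrite -mulr_sumr ler_wpM2l ?exprn_even_ge0//.
  have <- : series (exp_coeff `|x|) n = \sum_(k < n) exp_coeff `|x| k.
    by rewrite /series/= big_mkord.
  apply: nondecreasing_cvgn_le; last exact: is_cvg_series_exp_coeff.
  apply/nondecreasing_seqP => k; rewrite -subr_ge0 /series/= big_nat_recr//=.
  by rewrite addrAC subrr add0r /exp_coeff/= divr_ge0// exprn_ge0.
have cvgx : series (exp_coeff x) n @[n --> \oo] --> expR x.
  exact: is_cvg_series_exp_coeff.
have cvgu : series (exp_coeff x) (n + 4)%N @[n --> \oo] --> expR x.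
  by rewrite cvg_shiftn.
have limu := cvg_lim (@Rhausdorff R) cvgu.
have {}cvgu : cvgn (fun n => series (exp_coeff x) (n + 4)%N).
  by apply/cvg_ex; exists (expR x).
rewrite -limu ler_distl; apply/andP; split.
  apply: limr_ge => //; apply: nearW => n.
  by have := bnd n; rewrite ler_distl => /andP[].
apply: limr_le => //; apply: nearW => n.
by have := bnd n; rewrite ler_distl => /andP[].
Qed.

(** For [y < 1] this is [(1 - y) * expR y <= 1] multiplied by [1 + y]. *)
Lemma expR_quadratic_ub y : 0 <= y -> expR y <= 1 + y + y ^+ 2 * expR y.
Proof.
move=> y0; have [y1|y1] := leP 1 y.
  have : expR y <= y ^+ 2 * expR y by rewrite ler_peMl ?expR_ge0// exprn_ege1.
  by lra.
have h : (1 - y) * expR y <= 1.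
  have := expR_ge1Dx (- y); rewrite expRN => h.
  by rewrite -ler_pdivlMr ?expR_gt0// mul1r.
have := ler_wpM2r (addr_ge0 ler01 y0) h.
by nra.
Qed.

(** Comes from [(1 - y + y^2) * (1 + y) = 1 + y^3 >= 1] and [1 + y <= expR y]. *)
Lemma expRN_quadratic_ub y : 0 <= y -> expR (- y) <= 1 - y + y ^+ 2.
Proof.
move=> y0; rewrite expRN -[leLHS]mul1r ler_pdivrMr ?expR_gt0//.
have h := expR_ge1Dx y.
have y2 : 0 <= 1 - y + y ^+ 2 by nra.
apply: le_trans (ler_wpM2l y2 h).
have := exprn_ge0 3 y0; nra.
Qed.

Lemma sqr_le_expR y : 0 <= y -> y ^+ 2 <= 2 * expR y.
Proof.
move=> y0; have := expR_ge1Dxn 1%N y0; rewrite !factS fact0 !mulnE/=.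
lra.
Qed.

(** Powers of [x] are traded for [expR (x^2 / 16)], and [s <= 1/16] gives [|u| <= 1 + x^2 / 16], the
    source of the factor [expR 1]. The final exponent [x^2 / 4] stays below [x^2 / 2], so it is
    integrable for a standard Gaussian. *)
Lemma fourth_power_exp_ub s x : 0 <= s -> s <= 16^-1 ->
  (Num.sqrt s * x) ^+ 4 * expR `|Num.sqrt s * x| <=
  512 * expR 1 * s ^+ 2 * expR (x ^+ 2 / 4).
Proof.
move=> s0 s1; set u := Num.sqrt s * x.
have u2 : u ^+ 2 = s * x ^+ 2 by rewrite exprMn sqr_sqrtr.
have x20 : 0 <= x ^+ 2 by exact: sqr_ge0.
have u4 : u ^+ 4 <= 512 * s ^+ 2 * expR (x ^+ 2 / 16).
  have := @sqr_le_expR (x ^+ 2 / 16) ltac:(lra).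
  have -> : u ^+ 4 = s ^+ 2 * x ^+ 2 ^+ 2 by rewrite -exprMn -u2 -exprM.
  have : 0 <= s ^+ 2 by exact: sqr_ge0.
  move: (expR _) => E ? ?; nra.
have eu : expR `|u| <= expR 1 * expR (x ^+ 2 / 16).
  rewrite -expRD ler_expR.
  have : `|u| ^+ 2 = s * x ^+ 2 by rewrite real_normK ?num_real.
  have : 0 <= `|u| by [].
  by move: `|u| => a a0 a2; nra.
have -> : x ^+ 2 / 4 = x ^+ 2 / 16 + x ^+ 2 / 16 + x ^+ 2 / 8 by lra.
rewrite 2!expRD.
apply: (@le_trans _ _ ((512 * s ^+ 2 * expR (x ^+ 2 / 16)) *
    (expR 1 * expR (x ^+ 2 / 16)))).
  by apply: ler_pM => //; rewrite ?exprn_even_ge0// expR_ge0.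
have e8 : 1 <= expR (x ^+ 2 / 8) by apply: le_trans (expR_ge1Dx _); lra.
set a := expR (x ^+ 2 / 16); set b := expR 1; set c := expR (x ^+ 2 / 8) in e8 *.
have -> : 512 * b * s ^+ 2 * (a * a * c) = (512 * s ^+ 2 * a * (b * a)) * c by ring.
apply: ler_peMr => //; apply: mulr_ge0; last by apply: mulr_ge0; exact: expR_ge0.
by apply: mulr_ge0; [apply: mulr_ge0; [lra|exact: sqr_ge0]|exact: expR_ge0].
Qed.

Lemma cosh_quadratic x s : 0 <= s -> s <= 16^-1 ->
  `|expR (Num.sqrt s * x) + expR (- (Num.sqrt s * x)) - 2 - s * x ^+ 2| <=
  1024 * expR 1 * s ^+ 2 * expR (x ^+ 2 / 4).
Proof.
move=> s0 s1; have F := fourth_power_exp_ub x s0 s1.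
set u := Num.sqrt s * x in F *.
have -> : s * x ^+ 2 = u ^+ 2 by rewrite exprMn sqr_sqrtr.
have := expR_taylor3 u; have := expR_taylor3 (- u).
rewrite normrN !ler_norml => /andP[h1 h2] /andP[h3 h4].
have n2 : (- u) ^+ 2 = u ^+ 2 by ring.
have n3 : (- u) ^+ 3 = - u ^+ 3 by ring.
have n4 : (- u) ^+ 4 = u ^+ 4 by ring.
move: F h1 h2 h3 h4; rewrite n2 n3 n4.
move: (expR u) (expR (- u)) (expR `|u|) (expR 1) (expR (x ^+ 2 / 4)) => a b c d e.
by move=> F h1 h2 h3 h4; apply/andP; split; lra.
Qed.

(** Combines the quadratic bound at [y = s * x^2] with [s * x^2 <= 2 * cosh (sqrt s * x) - 2 +
    error]. Both sides are arranged as sums of nonnegative terms, so that they can be integrated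
    without subtraction. *)
Lemma exp_sqr_ub s x : 0 <= s -> s <= 16^-1 ->
  1 + expR (s * x ^+ 2) <= expR (Num.sqrt s * x) + expR (- (Num.sqrt s * x)) +
    2048 * expR 1 * s ^+ 2 * expR (x ^+ 2 / 4).
Proof.
move=> s0 s1; have := cosh_quadratic x s0 s1; rewrite ler_norml => /andP[h _].
have x20 : 0 <= x ^+ 2 by exact: sqr_ge0.
have h2 := expR_quadratic_ub (mulr_ge0 s0 x20).
suff : (s * x ^+ 2) ^+ 2 * expR (s * x ^+ 2) <=
    1024 * expR 1 * s ^+ 2 * expR (x ^+ 2 / 4) by lra.
have h3 := @sqr_le_expR (x ^+ 2 / 8) ltac:(lra).
have h4 : expR (s * x ^+ 2) <= expR (x ^+ 2 / 8) by rewrite ler_expR; nra.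
have h5 : 1 <= expR 1 :> R by apply: le_trans (expR_ge1Dx _); lra.
have -> : x ^+ 2 / 4 = x ^+ 2 / 8 + x ^+ 2 / 8 by lra.
rewrite expRD.
have h6 : (s * x ^+ 2) ^+ 2 <= 128 * s ^+ 2 * expR (x ^+ 2 / 8).
  rewrite exprMn; have := sqr_ge0 s; move: h3; move: (expR _) => E; nra.
apply: (@le_trans _ _ ((128 * s ^+ 2 * expR (x ^+ 2 / 8)) * expR (x ^+ 2 / 8))).
  by apply: ler_pM => //; rewrite ?sqr_ge0 ?expR_ge0.
have : 0 <= s ^+ 2 * (expR (x ^+ 2 / 8) * expR (x ^+ 2 / 8)).
  by rewrite mulr_ge0 ?sqr_ge0// mulr_ge0// expR_ge0.
move: h5; move: (expR 1) (expR (x ^+ 2 / 8)) (s ^+ 2) => a b c; nra.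
Qed.

(** The [cosh] terms now stand on the left, because [- s * x^2] calls for the lower bound [s * x^2
    >= 2 * cosh (sqrt s * x) - 2 - error]. *)
Lemma exp_negsqr_ub s x : 0 <= s -> s <= 16^-1 ->
  expR (- (s * x ^+ 2)) + (expR (Num.sqrt s * x) + expR (- (Num.sqrt s * x))) <=
  3 + 2048 * expR 1 * s ^+ 2 * expR (x ^+ 2 / 4).
Proof.
move=> s0 s1; have := cosh_quadratic x s0 s1; rewrite ler_norml => /andP[_ h].
have x20 : 0 <= x ^+ 2 by exact: sqr_ge0.
have h2 := expRN_quadratic_ub (mulr_ge0 s0 x20).
suff : (s * x ^+ 2) ^+ 2 <= 1024 * expR 1 * s ^+ 2 * expR (x ^+ 2 / 4) by lra.
have h3 := @sqr_le_expR (x ^+ 2 / 4) ltac:(lra).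
have h5 : 1 <= expR 1 :> R by apply: le_trans (expR_ge1Dx _); lra.
have : 0 <= s ^+ 2 * expR (x ^+ 2 / 4) by rewrite mulr_ge0 ?sqr_ge0 ?expR_ge0.
have h6 : (s * x ^+ 2) ^+ 2 <= 32 * s ^+ 2 * expR (x ^+ 2 / 4).
  rewrite exprMn; have := sqr_ge0 s; move: h3; move: (expR _) => E; nra.
move: h5 h6; move: (expR 1) (expR (x ^+ 2 / 4)) (s ^+ 2) => a b c; nra.
Qed.

End ExpBounds.

(** * Exponential moments of a Gaussian variable and of its square *)

Section GaussianMoments.
Local Open Scope ereal_scope.
Context (R : realType).
Notation mu := (@lebesgue_measure R).

Lemma ge0_integral_normal_prob (m s : R) (f : R -> R) :
  measurable_fun setT f -> (forall x, 0 <= f x)%R ->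
  \int[normal_prob m s]_x (f x)%:E = \int[mu]_x (normal_pdf m s x * f x)%:E.
Proof.
move=> mf f0; transitivity (\int[normal_prob m s]_x (cst 1 x * f x)%R%:E).
  by apply: eq_integral => x _; rewrite mul1r.
apply: (eq_integral_weight_comp (X1 := idfun) (X2 := idfun)) => //=.
- exact: measurable_id.
- by move=> x; exact: normal_pdf_ge0.
- exact: measurable_normal_pdf.
- exact: measurable_id.
move=> B mB; transitivity (normal_prob m s B).
  rewrite -[in RHS](setIT B) -integral_indic//.
  by apply: eq_integral => x _; rewrite mul1r.
rewrite /normal_prob [LHS]integral_mkcond; apply: eq_integral => x _.
by rewrite patchE indicE; case: ifP => _; rewrite ?mulr1 ?mulr0.
Qed.

(** Completing the square: the tilt by [expR (lam * x)] moves the mean to [lam]. *)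
Lemma normal_prob_mgf (lam : R) :
  \int[normal_prob 0 1]_x (expR (lam * x))%:E = (expR (lam ^+ 2 / 2))%:E.
Proof.
rewrite ge0_integral_normal_prob; last 2 first.
- by apply: measurableT_comp => //; exact: measurable_funM.
- by move=> x; exact: expR_ge0.
transitivity (\int[mu]_x ((expR (lam ^+ 2 / 2))%:E * (normal_pdf lam 1 x)%:E)).
  apply: eq_integral => x _; rewrite -EFinM; congr EFin.
  rewrite !normal_pdfE ?oner_eq0// /normal_fun mulrCA -mulrA; congr (_ * _)%R.
  by rewrite -!expRD; congr expR; field.
rewrite ge0_integralZl_EFin ?expR_ge0//.
- by rewrite integral_normal_pdf mule1.
- by move=> x _; rewrite lee_fin normal_pdf_ge0.
- by apply/measurable_EFinP; exact: measurable_normal_pdf.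
Qed.

(** The integrand times the standard density is, up to the ratio of the peaks, the density of
    variance two. *)
Lemma normal_prob_exp_sqr :
  \int[normal_prob 0 1]_x (expR (x ^+ 2 / 4))%:E =
  (normal_peak 1 / normal_peak (Num.sqrt 2) : R)%:E.
Proof.
have s20 : Num.sqrt 2 != 0%R :> R by rewrite gt_eqF// sqrtr_gt0.
have p0 := normal_peak_gt0 s20.
rewrite ge0_integral_normal_prob; last 2 first.
- apply: measurableT_comp => //; apply: measurable_funM => //.
- by move=> x; exact: expR_ge0.
transitivity (\int[mu]_x ((normal_peak 1 / normal_peak (Num.sqrt 2))%:E *
    (normal_pdf 0 (Num.sqrt 2) x)%:E)).
  apply: eq_integral => x _; rewrite -EFinM; congr EFin.
  rewrite !normal_pdfE ?oner_eq0// /normal_fun mulrA divfK ?gt_eqF//.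
  rewrite -mulrA; congr (_ * _)%R.
  by rewrite -!expRD sqr_sqrtr//; congr expR; field.
rewrite ge0_integralZl_EFin.
- by rewrite integral_normal_pdf mule1.
- exact: measurableT.
- by move=> x _; rewrite lee_fin normal_pdf_ge0.
- by apply/measurable_EFinP; exact: measurable_normal_pdf.
- by rewrite divr_ge0// normal_peak_ge0.
Qed.

Context d (T : measurableType d) (P : probability T R) (g : T -> R).
Hypothesis mg : measurable_fun setT g.
Hypothesis mgf_g : forall lam : R,
  \int[P]_w (expR (lam * g w))%:E = (expR (lam ^+ 2 / 2))%:E.

(* Averaging [exp (lam * g)] over a Gaussian [lam] produces [exp (g ^ 2 / 4)]. *)
Lemma gaussian_mgf_exp_sqr :
  \int[P]_w (expR (g w ^+ 2 / 4))%:E =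
  (normal_peak 1 / normal_peak (Num.sqrt 2) : R)%:E.
Proof.
(* Chosen so that averaging over [h] gives [expR (c^2 * g^2 / 2) = expR (g^2 / 4)]; after the
   exchange of integrals, averaging over [g] gives [expR (h^2 / 4)], a moment of the standard normal
   law. *)
pose c : R := Num.sqrt 2^-1.
have c2 : (c ^+ 2 = 2^-1)%R by rewrite sqr_sqrtr.
transitivity (\int[P]_w \int[normal_prob 0 1]_h (expR (c * (g w * h)))%:E).
  apply: eq_integral => w _; under eq_integral do rewrite mulrA.
  by rewrite normal_prob_mgf exprMn c2; congr (expR _)%:E; field.
have mf : measurable_fun [set: T * R] (fun z => (expR (c * (g z.1 * z.2)))%:E).
  apply/measurable_EFinP; apply: measurableT_comp => //.
  apply: measurable_funM => //; apply: measurable_funM => //.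
  exact: measurableT_comp.
rewrite (@fubini_tonelli _ _ _ _ _ P (normal_prob 0 1) _ mf)/=; last first.
  by move=> z; rewrite lee_fin expR_ge0.
rewrite -normal_prob_exp_sqr; apply: eq_integral => h _.
transitivity (\int[P]_w (expR ((c * h) * g w))%:E).
  by apply: eq_integral => w _; rewrite [(g w * h)%R]mulrC mulrA.
by rewrite mgf_g exprMn c2; congr (expR _)%:E; lra.
Qed.

End GaussianMoments.

(** * Two-sided Chernoff bound for sums of squares *)

Section ChiSquareConcentration.
Local Open Scope ereal_scope.
Context (R : realType).

(** The first summand is the error coefficient of the [cosh] comparison times the moment of
    [expR (g^2 / 4)]. The [8] absorbs the second-order term of [2 * expR (s / 2)] and guarantees
    [t / (2 * chi_const) <= 1/16] for [t <= 1]. *)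
Definition chi_const : R :=
  (2048 * expR 1 * (normal_peak 1 / normal_peak (Num.sqrt 2)) + 8)%R.

Lemma chi_const_ge8 : (8 <= chi_const)%R.
Proof.
have h1 : (0 <= normal_peak 1 / normal_peak (Num.sqrt 2) :> R)%R.
  by rewrite divr_ge0// normal_peak_ge0.
have h2 : (0 <= 2048 * expR 1 :> R)%R by have := @expR_ge0 R 1; lra.
by have := mulr_ge0 h2 h1; rewrite /chi_const; lra.
Qed.

Context d (T : measurableType d) (P : probability T R).

(** Integrating the pointwise comparisons gives [2 * expR (s / 2) - 1] and [3 - 2 * expR (s / 2)],
    each plus a multiple of [s^2]. To first order these are [1 + s] and [1 - s], and
    [1 + y <= expR y] concludes. *)
Lemma integral_exp_sqr_ub (g : T -> R) (s : R) :
  measurable_fun setT g ->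
  (forall lam : R, \int[P]_w (expR (lam * g w))%:E = (expR (lam ^+ 2 / 2))%:E) ->
  (0 <= s)%R -> (s <= 16^-1)%R ->
  \int[P]_w (expR (s * g w ^+ 2))%:E <= (expR (s + chi_const * s ^+ 2))%:E /\
  \int[P]_w (expR (- s * g w ^+ 2))%:E <= (expR (- s + chi_const * s ^+ 2))%:E.
Proof.
move=> mg mgfg s0 s1.
set K := (normal_peak 1 / normal_peak (Num.sqrt 2) : R)%R.
set D := (2048 * expR 1 : R)%R.
have K0 : (0 <= K)%R by rewrite divr_ge0// normal_peak_ge0.
have D0 : (0 <= D)%R by have := @expR_ge0 R 1; rewrite /D; lra.
have mexp (f : T -> R) : measurable_fun setT f ->
    measurable_fun setT (fun w => (expR (f w))%:E).
  by move=> mf; apply/measurable_EFinP; exact: measurableT_comp.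
have msqr (c : R) : measurable_fun setT (fun w => c * g w ^+ 2)%R.
  by apply: measurable_funM => //; exact: measurable_funX.
have mlin (c : R) : measurable_fun setT (fun w => c * g w)%R.
  exact: measurable_funM.
have e0 (f : T -> R) w : 0 <= (expR (f w))%:E by rewrite lee_fin expR_ge0.
have iD (f h : T -> \bar R) : (forall w, 0 <= f w) -> measurable_fun setT f ->
    (forall w, 0 <= h w) -> measurable_fun setT h ->
    \int[P]_w (f w + h w) = \int[P]_w f w + \int[P]_w h w.
  by move=> f0 mf h0 mh; exact: ge0_integralD.
have u2 : ((Num.sqrt s) ^+ 2 = s)%R by rewrite sqr_sqrtr.
have i1 : \int[P]_w (expR (Num.sqrt s * g w))%:E = (expR (s / 2))%:E.
  by rewrite mgfg u2.
have i2 : \int[P]_w (expR (- (Num.sqrt s * g w)))%:E = (expR (s / 2))%:E.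
  by under eq_integral do rewrite -mulNr; rewrite mgfg sqrrN u2.
have mN : measurable_fun setT (fun w => - (Num.sqrt s * g w))%R.
  exact: measurableT_comp.
have i12 : \int[P]_w ((expR (Num.sqrt s * g w))%:E + (expR (- (Num.sqrt s * g w)))%:E)
    = (2 * expR (s / 2))%:E.
  by rewrite (iD _ _ (e0 _) (mexp _ (mlin _)) (e0 _) (mexp _ mN)) i1 i2 -EFinD mulr_natl.
have m4 : measurable_fun setT (fun w => (expR (g w ^+ 2 / 4))%:E).
  by apply: mexp; apply: measurable_funM => //; exact: measurable_funX.
have i3 : \int[P]_w (D * s ^+ 2 * expR (g w ^+ 2 / 4))%:E = (D * s ^+ 2 * K)%:E.
  under eq_integral do rewrite EFinM.
  rewrite ge0_integralZl_EFin//.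
  - by rewrite gaussian_mgf_exp_sqr.
  - by rewrite mulr_ge0// sqr_ge0.
have m3 : measurable_fun setT (fun w => (D * s ^+ 2 * expR (g w ^+ 2 / 4))%:E).
  apply/measurable_EFinP; apply: measurable_funM => //.
  exact/measurable_EFinP.
have h3 w : 0 <= (D * s ^+ 2 * expR (g w ^+ 2 / 4))%:E.
  by rewrite lee_fin; apply: mulr_ge0; [rewrite mulr_ge0// sqr_ge0|exact: expR_ge0].
have c1 (c : R) : \int[P]_w (c%:E) = c%:E.
  transitivity (c%:E * 1); last exact: mule1.
  by rewrite -(probability_setT P); exact: integral_cst.
have s2e : (expR (s / 2) <= 1 + s / 2 + s ^+ 2 / 2)%R.
  have h := @expR_quadratic_ub _ (s / 2) ltac:(lra).
  have h' : (expR (s / 2) <= 2)%R.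
    have := @expR_ge1Dx _ (- (s / 2)); rewrite expRN => k.
    have := @expR_gt0 _ (s / 2); have : (2^-1 <= (expR (s / 2))^-1)%R by lra.
    by move=> k1 k2; move: k1; rewrite lef_pV2 ?posrE.
  have := sqr_ge0 s; nra.
have s2l := @expR_ge1Dx _ (s / 2).
have CE : chi_const = (D * K + 8)%R by rewrite /chi_const.
(* Moves a constant across an inequality in the extended reals; the infinite values of [I]
   contradict the hypotheses. *)
have fin_ub (I : \bar R) (a b : R) : 0 <= I -> I + a%:E <= b%:E -> I <= (b - a)%:E.
  by case: I => [r| |]//; rewrite -EFinD !lee_fin => _; lra.
split.
- apply: (@le_trans _ _ (2 * expR (s / 2) + D * s ^+ 2 * K - 1)%:E); last first.
    rewrite lee_fin; apply: le_trans (expR_ge1Dx _); rewrite CE.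
    by have := sqr_ge0 s; nra.
  apply: fin_ub; first by apply: integral_ge0 => w _; rewrite lee_fin expR_ge0.
  rewrite -[X in _ + X]c1.
  have e1 (w : T) : 0 <= (1 : R)%:E by rewrite lee_fin.
  have m1 : measurable_fun setT (fun _ : T => (1 : R)%:E) by [].
  rewrite -(iD _ _ (e0 _) (mexp _ (msqr s)) e1 m1).
  have m12 := emeasurable_funD (mexp _ (mlin (Num.sqrt s))) (mexp _ mN).
  have e12 w : 0 <= (expR (Num.sqrt s * g w))%:E + (expR (- (Num.sqrt s * g w)))%:E.
    by rewrite adde_ge0.
  rewrite EFinD -i12 -i3 -(iD _ _ e12 m12 h3 m3).
  apply: ge0_le_integral => //.
  - by move=> w _; apply: adde_ge0 => //; rewrite lee_fin expR_ge0.
  - by apply: emeasurable_funD => //; exact: mexp.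
  - apply: emeasurable_funD => //; apply: emeasurable_funD; exact: mexp.
  move=> w _; rewrite -!EFinD lee_fin [X in (X <= _)%R]addrC.
  exact: (exp_sqr_ub (g w) s0 s1).
- apply: (@le_trans _ _ (3 + D * s ^+ 2 * K - 2 * expR (s / 2))%:E); last first.
    rewrite lee_fin; apply: le_trans (expR_ge1Dx _); rewrite CE.
    by have := sqr_ge0 s; nra.
  apply: fin_ub; first by apply: integral_ge0 => w _; rewrite lee_fin expR_ge0.
  have e3 (w : T) : 0 <= (3 : R)%:E by rewrite lee_fin.
  have mc3 : measurable_fun setT (fun _ : T => (3 : R)%:E) by [].
  have m12 := emeasurable_funD (mexp _ (mlin (Num.sqrt s))) (mexp _ mN).
  have e12 w : 0 <= (expR (Num.sqrt s * g w))%:E + (expR (- (Num.sqrt s * g w)))%:E.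
    by rewrite adde_ge0.
  rewrite -i12 -(iD _ _ (e0 _) (mexp _ (msqr (- s)%R)) e12 m12).
  rewrite EFinD -(c1 3%R) -i3 -(iD _ _ e3 mc3 h3 m3).
  apply: ge0_le_integral => //.
  - by move=> w _; apply: adde_ge0 => //; exact: e12.
  - apply: emeasurable_funD; first exact: mexp.
    by apply: emeasurable_funD; exact: mexp.
  - exact: emeasurable_funD.
  by move=> w _; rewrite -!EFinD lee_fin mulNr; exact: exp_negsqr_ub.
Qed.

Context (I : finType) (g : I -> T -> R).
Hypothesis mg : forall i, measurable_fun setT (g i).
Hypothesis indep_g : forall B : I -> set R, (forall i, measurable (B i)) ->
  P (\bigcap_i (g i @^-1` B i)) = \prod_i P (g i @^-1` B i).

(** Markov's inequality for [expR (sg * S - a)], with independence factoring the expectation; the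
    sign of [sg] selects the upper or the lower tail. *)
Lemma chernoff_sum_sqr (a b sg : R) :
  (forall i, \int[P]_w (expR (sg * g i w ^+ 2))%:E <= (expR b)%:E) ->
  P [set w | a <= sg * \sum_i g i w ^+ 2]%R <= (expR (#|I|%:R * b - a))%:E.
Proof.
move=> hb; set A := [set w | _].
have mS : measurable_fun setT (fun w => sg * \sum_i g i w ^+ 2)%R.
  apply: measurable_funM => //; apply: measurable_sum => i.
  exact: measurable_funX.
have mA : measurable A.
  rewrite -[A]setTI; apply: (measurable_fun_le _ _ mS) => //.
have mE : measurable_fun setT (fun w => expR (sg * \sum_i g i w ^+ 2)).
  exact: measurableT_comp.
apply: (@le_trans _ _ (\int[P]_w (expR (- a) * expR (sg * \sum_i g i w ^+ 2))%:E)).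
  rewrite -(setIT A) -integral_indic//; apply: ge0_le_integral => //.
  - by apply/measurable_EFinP; exact: measurable_indic.
  - by apply/measurable_EFinP; exact: measurable_funM.
  move=> w _; rewrite lee_fin indicE -expRD.
  case: (boolP (w \in A)) => [|_]; last exact: expR_ge0.
  rewrite inE /A/= => h; apply: le_trans (expR_ge1Dx _); lra.
under eq_integral do rewrite EFinM mulr_sumr expR_sum.
rewrite ge0_integralZl_EFin; last 4 first.
- exact: measurableT.
- by move=> w _; rewrite lee_fin prodr_ge0// => i _; exact: expR_ge0.
- apply/measurable_EFinP.
  by move: mE; under eq_fun do rewrite mulr_sumr expR_sum.
- exact: expR_ge0.
rewrite (integral_prod_independent (f := fun _ x => expR (sg * x ^+ 2)) mg indep_g).
- rewrite [(_ - a)%R]addrC expRD EFinM lee_wpmul2l// ?lee_fin ?expR_ge0//.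
  apply: (@le_trans _ _ (\prod_(i : I) (expR b)%:E)); last first.
    by rewrite prodEFin prodr_const expRM_natl.
  have : 0 <= \prod_(i : I) \int[P]_w (expR (sg * g i w ^+ 2))%:E <=
      \prod_(i : I) (expR b)%:E.
    elim/big_ind2 : _ => [|x1 x2 y1 y2 /andP[? ?] /andP[? ?]|i _].
    - by rewrite lee01 lexx.
    - by rewrite mule_ge0// lee_pmul.
    - by rewrite hb andbT; apply: integral_ge0 => w _; rewrite lee_fin expR_ge0.
  by case/andP.
- by move=> i; apply: measurableT_comp => //; apply: measurable_funM.
- by move=> i x; exact: expR_ge0.
- by move=> i; apply: le_lt_trans (hb i) _; rewrite ltry.
Qed.

Hypothesis mgf_g : forall i (lam : R),
  \int[P]_w (expR (lam * g i w))%:E = (expR (lam ^+ 2 / 2))%:E.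

Lemma sum_sqr_concentration (t : R) : (0 < t)%R -> (t <= 1)%R ->
  P [set w | ~~ (`|\sum_i g i w ^+ 2 - #|I|%:R| <= t * #|I|%:R)%R] <=
  (2 * expR (- (#|I|%:R * (t ^+ 2 / (4 * chi_const)))))%:E.
Proof.
move=> t0 t1; have C8 := chi_const_ge8; set m : R := #|I|%:R.
have m0 : (0 <= m)%R by rewrite ler0n.
(* Minimises [- s * t + chi_const * s ^ 2], with value [- t ^ 2 / (4 * chi_const)]. *)
pose s := (t / (2 * chi_const))%R.
have C0 : (0 < chi_const)%R by lra.
have s0 : (0 <= s)%R by apply: divr_ge0; lra.
have s1 : (s <= 16^-1)%R by rewrite ler_pdivrMr; lra.
have sE : (- s * t + chi_const * s ^+ 2 = - (t ^+ 2 / (4 * chi_const)))%R.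
  by rewrite /s; field; rewrite gt_eqF.
have tE : (t ^+ 2 / (4 * chi_const) = s * t - chi_const * s ^+ 2)%R.
  by rewrite -[LHS]opprK -sE; ring.
have hu i := (integral_exp_sqr_ub (mg i) (mgf_g i) s0 s1).1.
have hl i := (integral_exp_sqr_ub (mg i) (mgf_g i) s0 s1).2.
have := @chernoff_sum_sqr (s * (1 + t) * m) _ _ hu.
have := @chernoff_sum_sqr (- s * (1 - t) * m) _ _ hl.
set B := [set w | _]; set A := [set w | _].
have -> : (m * (- s + chi_const * s ^+ 2) - - s * (1 - t) * m =
    - (m * (t ^+ 2 / (4 * chi_const))))%R.
  by rewrite tE; ring.
have -> : (m * (s + chi_const * s ^+ 2) - s * (1 + t) * m =
    - (m * (t ^+ 2 / (4 * chi_const))))%R.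
  by rewrite tE; ring.
move=> hB hA.
have mS c : measurable_fun setT (fun w => c * \sum_i g i w ^+ 2)%R.
  apply: measurable_funM => //; apply: measurable_sum => i.
  exact: measurable_funX.
have mA : measurable A by rewrite -[A]setTI; apply: (measurable_fun_le _ _ (mS _)).
have mB : measurable B by rewrite -[B]setTI; apply: (measurable_fun_le _ _ (mS _)).
apply: (@le_trans _ _ (P (A `|` B))); last first.
  apply: (le_trans (measureU2 P mA mB)).
  by rewrite mulr_natl mulr2n EFinD leeD.
apply: le_measure; rewrite ?inE; [|exact: measurableU|].
  have mS1 : measurable_fun setT (fun w => `|\sum_i g i w ^+ 2 - m|%R).
    apply: measurableT_comp => //; apply: measurable_funB => //.
    by apply: measurable_sum => i; exact: measurable_funX.
  rewrite (_ : [set w | _] =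
      ~` [set w | (`|\sum_i g i w ^+ 2 - m| <= t * m)%R]); last first.
    by apply/seteqP; split=> w /= /negP.
  apply: measurableC; rewrite -[X in measurable X]setTI.
  exact: (measurable_fun_le _ mS1).
have sp : (0 < s)%R by rewrite divr_gt0// mulr_gt0.
move=> w /=; rewrite -ltNge ltr_normr => /orP[h|h].
  by left; rewrite /A/= -mulrA ler_pM2l//; lra.
by right; rewrite /B/= -mulrA ler_nM2l ?oppr_lt0//; lra.
Qed.

End ChiSquareConcentration.

(** * Nets of lattice points *)

Section LatticeNet.
Context (R : realType) (p q : nat).
Local Notation mat := 'M[R]_(p, q).

Definition rmx (z : 'M[int]_(p, q)) : mat := map_mx intr z.

Lemma size_sum_fibers (T : eqType) (C : finType) (F : T -> C) (s : seq T) :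
  size s = (\sum_(c : C) count (fun z => F z == c) s)%N.
Proof.
elim: s => [|z s IHs]; first by rewrite big1.
rewrite /= big_split/= -IHs (bigD1 (F z))//= eqxx big1 ?addn0 ?add1n//.
by move=> c cz; rewrite eq_sym (negbTE cz).
Qed.

(** Greedy choice: a point close to a selected one is covered by it, any other point is added. *)
Lemma maximal_separated (T : eqType) (close : rel T) (L : seq T) :
  reflexive close -> symmetric close -> exists S : seq T,
    [/\ uniq S, {subset S <= L},
        {in S &, forall x y, close x y -> x = y} &
        {in L, forall x, exists2 y, y \in S & close x y}].
Proof.
move=> crefl csym; elim: L => [|x L [S [uS SL Ssep Scov]]]; first by exists [::].
have [/hasP[y yS cxy]|/hasPn xfar] := boolP (has (close x) S).
  exists S; split => //; first by move=> z /SL zL; rewrite inE zL orbT.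
  by move=> z; rewrite inE => /predU1P[->|/Scov//]; exists y.
exists (x :: S); split.
- rewrite /= uS andbT; apply/negP => /xfar; by rewrite crefl.
- by move=> z; rewrite !inE => /predU1P[->|/SL ->]; rewrite ?eqxx ?orbT.
- move=> y z; rewrite !inE => /predU1P[->|yS] /predU1P[->|zS]//.
  + by move=> c; move: (xfar _ zS); rewrite c.
  + by rewrite csym => c; move: (xfar _ yS); rewrite c.
  + exact: Ssep.
- move=> z; rewrite inE => /predU1P[->|/Scov[y yS czy]].
    by exists x; rewrite ?inE ?eqxx.
  by exists y => //; rewrite inE yS orbT.
Qed.

(* [ball t] is the closed ball of radius [t] of a norm on matrices. *)
Variable ball : R -> mat -> Prop.
Hypothesis ballD : forall s t A B, ball s A -> ball t B -> ball (s + t) (A + B).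
Hypothesis ballZ : forall c t A, ball t A -> ball (`|c| * t) (c *: A).
Hypothesis ball_entry : forall t A i j, ball t A -> `|A i j| <= t.
Hypothesis le_ball : forall s t A, s <= t -> ball s A -> ball t A.
Variable K : R.
Hypothesis ball_of_entries : forall h (A : mat), 0 <= h -> (forall i j, `|A i j| <= h) ->
  ball (K * h) A.

Lemma ballN t A : ball t A -> ball t (- A).
Proof. by move=> /(ballZ (-1)); rewrite normrN1 mul1r scaleN1r. Qed.

Lemma ballB s t A B : ball s A -> ball t B -> ball (s + t) (A - B).
Proof. by move=> hA /ballN; exact: ballD. Qed.

Lemma ball0 t : 0 <= t -> ball t 0.
Proof.
move=> t0; apply: (le_ball t0); rewrite -(mulr0 K); apply: ball_of_entries => // i j.
by rewrite mxE normr0.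
Qed.

(** The entries of a point of the ball are bounded by [t], so the candidates are matrices over a
    finite ordinal type, shifted to be centred at zero. *)
Lemma lattice_ball (t : R) : exists L : seq 'M[int]_(p, q),
  uniq L /\ forall z : 'M[int]_(p, q), z \in L <-> ball t (rmx z).
Proof.
pose k := Num.bound t.
pose dec (y : 'M['I_(k + k).+1]_(p, q)) : 'M[int]_(p, q) :=
  map_mx (fun a : 'I__ => (a : nat)%:Z - k%:Z) y.
exists [seq z <- undup [seq dec y | y : 'M['I_(k + k).+1]_(p, q)] |
  `[< ball t (rmx z) >]].
split; first by rewrite filter_uniq ?undup_uniq.
move=> z; rewrite mem_filter mem_undup; split=> [/andP[/asboolP//]|bz].
apply/andP; split; first exact/asboolP.
have zk i j : `|z i j| <= k%:Z.
  have := ball_entry i j bz; rewrite mxE => h.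
  rewrite -(ler_int R) intr_norm; apply: le_trans h _.
  have := unstable.ltr_norm_bound t; have := ler_norm t; rewrite /k -pmulrn; lra.
apply/mapP.
exists (\matrix_(i < p, j < q) (inord (absz (z i j + k%:Z)) : 'I_(k + k).+1)).
  by rewrite mem_enum.
apply/matrixP => i j; rewrite !mxE inordK.
  have := zk i j; rewrite ler_norml => /andP[h1 h2].
  by rewrite gez0_abs ?addrK// -lerBlDr sub0r.
have := zk i j; rewrite ler_norml => /andP[h1 h2]; rewrite -ltz_nat gez0_abs.
  by rewrite -addn1 !PoszD ltzD1 lerD2r.
by rewrite -lerBlDr sub0r.
Qed.


(* Reducing modulo [2k] is at most [(2k)^(pq)]-to-one up to translation, and two
   congruent points of [ball (k t)] differ by [2k] times a point of [ball t]. *)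
Lemma lattice_ball_doubling (k : nat) (t : R) (L L' : seq 'M[int]_(p, q)) :
  (0 < k)%N -> uniq L -> uniq L' ->
  (forall z, z \in L -> ball (k%:R * t) (rmx z)) ->
  (forall z, ball t (rmx z) -> z \in L') ->
  (size L <= (2 * k) ^ (p * q) * size L')%N.
Proof.
move=> k0 uL uL' LB BL'.
have k2 : (0 < 2 * k)%N by rewrite muln_gt0.
pose F (z : 'M[int]_(p, q)) : 'M['I_(2 * k)]_(p, q) :=
  map_mx (fun a => Ordinal (ltn_pmod `|(a %% (2 * k)%N%:Z)%Z|%N k2)) z.
rewrite (size_sum_fibers F L).
apply: (@leq_trans (\sum_(c : 'M['I_(2 * k)]_(p, q)) size L')%N); last first.
  by rewrite sum_nat_const card_mx card_ord.
apply: leq_sum => c _; rewrite -size_filter.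
case E : [seq z <- L | F z == c] => [//|z0 s]; rewrite -E.
have : z0 \in [seq z <- L | F z == c] by rewrite E inE eqxx.
rewrite mem_filter => /andP[/eqP Fz0 z0L].
pose h (z : 'M[int]_(p, q)) : 'M[int]_(p, q) :=
  map_mx (fun a => (a %/ (2 * k)%N%:Z)%Z) (z - z0).
have hE z : F z == c -> z = z0 + h z *~ (2 * k)%N%:Z.
  move=> /eqP; rewrite -Fz0 => /matrixP Fz; apply/matrixP => i j.
  have k20 : (2 * k)%N%:Z != 0 by rewrite eqz_nat -lt0n.
  have {Fz} : (z i j = z0 i j %[mod (2 * k)%N%:Z])%Z.
    have := Fz i j; rewrite !mxE => /(congr1 val)/=.
    set a := (z i j %% _)%Z; set b := (z0 i j %% _)%Z.
    have a0 : 0 <= a by exact: modz_ge0.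
    have b0 : 0 <= b by exact: modz_ge0.
    have ltk (e : int) : 0 <= (e %% (2 * k)%N%:Z)%Z ->
        (absz (e %% (2 * k)%N%:Z)%Z < 2 * k)%N.
      by move=> c0; rewrite -ltz_nat gez0_abs// ltz_pmod.
    rewrite !modn_small ?ltk// => /(congr1 Posz).
    by rewrite !gez0_abs.
  move/eqP; rewrite eqz_mod_dvd => /divzK; rewrite !mxE -scaler_int !mxE.
  by rewrite intz mulrC => ->; rewrite subrKC.
rewrite -(size_map h [seq z <- L | F z == c]); apply: uniq_leq_size.
  rewrite map_inj_in_uniq ?filter_uniq// => x y.
  by rewrite !mem_filter => /andP[/hE xE _] /andP[/hE yE _] xy; rewrite xE yE xy.
move=> y /mapP[z]; rewrite mem_filter => /andP[/hE zE zL] ->; apply: BL'.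
have -> : rmx (h z) = (2 * k)%:R^-1 *: (rmx z - rmx z0).
  have e : rmx z = (2 * k)%:R *: rmx (h z) + rmx z0.
    by rewrite {1}zE /rmx raddfD/= raddfMz/= addrC -scaler_int -pmulrn.
  rewrite e addrK scalerA mulVf ?scale1r//.
  by rewrite pnatr_eq0 -lt0n.
rewrite [t](_ : _ = `|(2 * k)%:R^-1| * (k%:R * t + k%:R * t)); last first.
  rewrite ger0_norm ?invr_ge0// natrM; have := k0; rewrite -(ltr0n R) => k0'.
  by field; rewrite gt_eqF.
by apply: ballZ; apply: ballB; exact: LB.
Qed.

(** Packing: the translates of the integer points of [ball t] by a maximal [2t]-separated set [S] of
    [ball ((k - 1) * t)] are pairwise disjoint and lie in [ball (k * t)]. Hence [size S * size L']
    is at most [(2k)^(pq) * size L'], and [L'] contains [0], so its size cancels. *)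
Lemma lattice_net (k : nat) (t : R) : (0 < k)%N -> 0 <= t ->
  exists S : seq 'M[int]_(p, q),
    (size S <= (2 * k) ^ (p * q))%N /\
    forall z, ball ((k%:R - 1) * t) (rmx z) ->
      exists2 s, s \in S & ball (t + t) (rmx (z - s)).
Proof.
move=> k0 t0.
have [L [uL LP]] := lattice_ball ((k%:R - 1) * t).
have [L' [uL' LP']] := lattice_ball t.
have [Lk [uLk LPk]] := lattice_ball (k%:R * t).
have rmxB z s : rmx (z - s) = rmx z - rmx s by rewrite /rmx raddfB.
pose close z s := `[< ball (t + t) (rmx (z - s)) >].
have crefl : reflexive close.
  by move=> z; apply/asboolP; rewrite rmxB subrr; apply: ball0; rewrite addr_ge0.
have csym : symmetric close.
  by move=> z s; apply/asboolP/asboolP => /ballN; rewrite !rmxB opprB.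
have [S [uS SL Ssep Scov]] := maximal_separated L crefl csym.
exists S; split.
- rewrite -(@leq_pmul2r (size L')); last first.
    rewrite lt0n size_eq0; apply/eqP => L'0.
    have : (0 : 'M[int]_(p, q)) \in L' by apply/LP'; rewrite /rmx raddf0; exact: ball0.
    by rewrite L'0.
  rewrite -(size_allpairs (fun s z => s + z)).
  have dbl : (size Lk <= (2 * k) ^ (p * q) * size L')%N.
    by apply: (@lattice_ball_doubling k t) => // z; [move/LPk|move/LP'].
  apply: leq_trans dbl.
  apply: uniq_leq_size.
    apply: allpairs_uniq => // -[s z] [s' z'].
    move=> /allpairsP[[a b]/= [aS bL' [-> ->]]].
    move=> /allpairsP[[a' b']/= [aS' bL'' [-> ->]]] /= e.
    have aa' : a = a'.
      apply: Ssep => //; apply/asboolP.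
      have -> : a - a' = b' - b by rewrite -[a](addrK b) e addrAC [a' + b']addrC addrK.
      by rewrite rmxB; apply: ballB; exact/LP'.
    by move: e; rewrite aa' => /addrI ->.
  move=> _ /allpairsP[[s z] /= [sS zL' ->]]; apply/LPk.
  rewrite /rmx raddfD [k%:R * t](_ : _ = (k%:R - 1) * t + t); last by ring.
  by apply: ballD; [exact/LP/SL|exact/LP'].
- by move=> z /LP /Scov [s sS /asboolP]; exists s.
Qed.

(** A point is scaled up and rounded to integers, at the cost of an error in [ball K]. The constant
    [K] only fixes the lattice scale, so a crude dimension-dependent [K] affects neither the
    cardinality nor the mesh. *)
Lemma norm_net (k : nat) : (0 < k)%N -> 0 <= K -> exists S : seq mat,
  (size S <= (2 * k.+1) ^ (p * q))%N /\
  forall A, ball 1 A -> exists2 s, s \in S & ball (3 / k%:R) (A - s).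
Proof.
(* With this [c] the rounded points lie in radius [k * t], the one covered by the lattice net of
   parameter [k.+1]. Taking [t] large against [K] keeps the mesh [(2 * t + K) / c] at most
   [3 / k]. *)
move=> k0 K0; pose t := 8 * K + 1; pose c := k%:R * t - K.
have k1 : 1 <= k%:R :> R by rewrite ler1n.
have t1 : 1 <= t by rewrite /t; lra.
have c0 : 0 < c by rewrite /c /t; nra.
have t0 : 0 <= t by lra.
have [S [szS Scov]] := lattice_net (ltn0Sn k) t0.
have kE : k.+1%:R - 1 = k%:R :> R by rewrite -natr1 addrK.
rewrite kE in Scov.
exists [seq c^-1 *: rmx s | s <- S]; split; first by rewrite size_map.
move=> A A1; pose z : 'M[int]_(p, q) := map_mx Num.floor (c *: A).
pose E := rmx z - c *: A.
have ballE : ball K E.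
  rewrite -[K]mulr1; apply: ball_of_entries => // i j; rewrite !mxE distrC.
  have /andP[h1 h2] := floor_itv (c * A i j).
  by rewrite ler_norml; move: h2; rewrite intrD; lra.
have zE : rmx z = c *: A + E by rewrite /E subrKC.
have zB : ball (k%:R * t) (rmx z).
  rewrite zE [k%:R * t](_ : _ = `|c| * 1 + K); last by rewrite gtr0_norm// /c; ring.
  by apply: ballD => //; exact: ballZ.
have [s sS sz] := Scov _ zB.
exists (c^-1 *: rmx s); first exact: map_f.
have -> : A - c^-1 *: rmx s = c^-1 *: (rmx (z - s) - E).
  rewrite [rmx (z - s)](_ : _ = rmx z - rmx s); last by rewrite /rmx raddfB.
  rewrite zE addrAC addrK scalerBr scalerA.
  by rewrite mulVf ?scale1r ?gt_eqF.
apply: (@le_ball (`|c^-1| * (t + t + K))); last by apply: ballZ; exact: ballB.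
rewrite gtr0_norm ?invr_gt0// mulrC ler_pdivrMr// mulrAC ler_pdivlMr; last by lra.
by rewrite /c /t; nra.
Qed.

End LatticeNet.

(** * Low-rank matrices *)

Section Frobenius.
Context (R : realType).

Lemma frob_dotE n N (A B : 'M[R]_(n, N)) : frob_dot A B = \tr (A *m B^T).
Proof.
by apply: eq_bigr => k _; rewrite mxE; apply: eq_bigr => l _; rewrite mxE.
Qed.

Lemma frob_dotC n N (A B : 'M[R]_(n, N)) : frob_dot A B = frob_dot B A.
Proof. by apply: eq_bigr => k _; apply: eq_bigr => l _; rewrite mulrC. Qed.

Lemma frob_dotDl n N (A B C : 'M[R]_(n, N)) :
  frob_dot (A + B) C = frob_dot A C + frob_dot B C.
Proof. by rewrite !frob_dotE mulmxDl raddfD. Qed.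

Lemma frob_dotZl n N c (A B : 'M[R]_(n, N)) :
  frob_dot (c *: A) B = c * frob_dot A B.
Proof. by rewrite !frob_dotE -scalemxAl mxtraceZ. Qed.

Lemma frob_dotDr n N (A B C : 'M[R]_(n, N)) :
  frob_dot C (A + B) = frob_dot C A + frob_dot C B.
Proof. by rewrite frob_dotC frob_dotDl !(frob_dotC _ C). Qed.

Lemma frob_dotZr n N c (A B : 'M[R]_(n, N)) :
  frob_dot A (c *: B) = c * frob_dot A B.
Proof. by rewrite frob_dotC frob_dotZl frob_dotC. Qed.

Lemma frob_dot_ge0 n N (A : 'M[R]_(n, N)) : 0 <= frob_dot A A.
Proof.
by apply: sumr_ge0 => k _; apply: sumr_ge0 => l _; rewrite -expr2 sqr_ge0.
Qed.

Lemma sqr_entry_le_frob_dot n N (A : 'M[R]_(n, N)) k l :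
  A k l ^+ 2 <= frob_dot A A.
Proof.
rewrite /frob_dot (bigD1 k)//= (bigD1 l)//= -expr2 -addrA lerDl addr_ge0//.
  by apply: sumr_ge0 => j _; rewrite -expr2 sqr_ge0.
by apply: sumr_ge0 => i _; apply: sumr_ge0 => j _; rewrite -expr2 sqr_ge0.
Qed.

Lemma frob_dot_eq0 n N (A : 'M[R]_(n, N)) : frob_dot A A = 0 -> A = 0.
Proof.
move=> A0; apply/matrixP => k l; rewrite mxE; apply/eqP.
by have := sqr_entry_le_frob_dot A k l; rewrite A0 -sqrf_eq0 eq_le sqr_ge0 andbT.
Qed.

Lemma frob_norm_ge0 n N (A : 'M[R]_(n, N)) : 0 <= frob_norm A.
Proof. exact: sqrtr_ge0. Qed.

Lemma sqr_frob_norm n N (A : 'M[R]_(n, N)) : frob_norm A ^+ 2 = frob_dot A A.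
Proof. by rewrite sqr_sqrtr// frob_dot_ge0. Qed.

Lemma frob_cauchy_schwarz n N (A B : 'M[R]_(n, N)) :
  frob_dot A B ^+ 2 <= frob_dot A A * frob_dot B B.
Proof.
have [b0|b0] := eqVneq (frob_dot B B) 0.
  rewrite (frob_dot_eq0 b0) !frob_dotE trmx0 !mulmx0 raddf0 expr0n mulr0//.
have bp : 0 < frob_dot B B by rewrite lt0r b0 frob_dot_ge0.
have := frob_dot_ge0 (frob_dot B B *: A + (- frob_dot A B) *: B).
rewrite frob_dotDl !frob_dotDr !frob_dotZl !frob_dotZr (frob_dotC B A).
set a := frob_dot A A; set b := frob_dot B B in bp *; set c := frob_dot A B.
by move=> h; rewrite -(ler_pM2l bp); nra.
Qed.

Lemma frob_dot_le_norm n N (A B : 'M[R]_(n, N)) :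
  frob_dot A B <= frob_norm A * frob_norm B.
Proof.
apply: le_trans (ler_norm _) _; rewrite -sqrtr_sqr -sqrtrM ?frob_dot_ge0//.
by rewrite ler_sqrt ?frob_cauchy_schwarz// mulr_ge0// frob_dot_ge0.
Qed.

Lemma frob_normD n N (A B : 'M[R]_(n, N)) :
  frob_norm (A + B) <= frob_norm A + frob_norm B.
Proof.
rewrite -(@ler_pXn2r _ 2) ?nnegrE ?addr_ge0 ?frob_norm_ge0//.
rewrite sqr_frob_norm frob_dotDl !frob_dotDr (frob_dotC B A) -!sqr_frob_norm.
by have := frob_dot_le_norm A B; nra.
Qed.

Lemma frob_normZ n N c (A : 'M[R]_(n, N)) :
  frob_norm (c *: A) = `|c| * frob_norm A.
Proof.
by rewrite /frob_norm frob_dotZl frob_dotZr mulrA -expr2 sqrtrM ?sqr_ge0// sqrtr_sqr.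
Qed.

Lemma frob_normN n N (A : 'M[R]_(n, N)) : frob_norm (- A) = frob_norm A.
Proof. by rewrite -scaleN1r frob_normZ normrN1 mul1r. Qed.

Lemma frob_norm0 n N : frob_norm (0 : 'M[R]_(n, N)) = 0.
Proof. by rewrite -(scale0r 0) frob_normZ normr0 mul0r. Qed.

Lemma entry_le_frob_norm n N (A : 'M[R]_(n, N)) k l : `|A k l| <= frob_norm A.
Proof. by rewrite -sqrtr_sqr ler_sqrt ?frob_dot_ge0// sqr_entry_le_frob_dot. Qed.

Lemma frob_norm_of_entries n N (A : 'M[R]_(n, N)) h : 0 <= h ->
  (forall i j, `|A i j| <= h) -> frob_norm A <= (n * N)%:R * h.
Proof.
move=> h0 hA.
rewrite -(@ler_pXn2r _ 2) ?nnegrE ?mulr_ge0 ?frob_norm_ge0// sqr_frob_norm.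
apply: (@le_trans _ _ (\sum_(i < n) \sum_(j < N) h ^+ 2)).
  apply: ler_sum => i _; apply: ler_sum => j _.
  by rewrite -expr2 -[_ ^+ 2]real_normK ?num_real// lerXn2r ?nnegrE.
rewrite !sumr_const !card_ord -mulrnA mulnC -[X in X <= _]mulr_natl.
rewrite exprMn ler_wpM2r ?sqr_ge0//.
by rewrite -natrX ler_nat; case: (n * N)%N => // e; rewrite -{1}[e.+1]expn1 leq_pexp2l.
Qed.

Lemma frob_dot_row_mx n N1 N2 (A : 'M[R]_(n, N1)) (B : 'M[R]_(n, N2)) :
  frob_dot (row_mx A B) (row_mx A B) = frob_dot A A + frob_dot B B.
Proof. by rewrite !frob_dotE tr_row_mx mul_row_col raddfD. Qed.

Lemma frob_norm_mulmx n r N (V : 'M[R]_(n, r)) (U : 'M[R]_(r, N)) :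
  frob_norm (V *m U) <= frob_norm V * frob_norm U.
Proof.
rewrite -sqrtrM ?frob_dot_ge0// ler_sqrt; last by rewrite mulr_ge0// frob_dot_ge0.
have -> : frob_dot U U = \sum_(j < N) \sum_(l < r) U l j * U l j.
  exact: exchange_big.
rewrite /frob_dot mulr_suml; apply: ler_sum => i _.
rewrite mulr_sumr; apply: ler_sum => j _.
have := @frob_cauchy_schwarz 1 r (row i V) (row j U^T).
have -> : frob_dot (row i V) (row j U^T) = (V *m U) i j.
  by rewrite /frob_dot big_ord1 mxE; apply: eq_bigr => l _; rewrite !mxE.
have -> : frob_dot (row i V) (row i V) = \sum_(l < r) V i l * V i l.
  by rewrite /frob_dot big_ord1; apply: eq_bigr => l _; rewrite !mxE.
have -> : frob_dot (row j U^T) (row j U^T) = \sum_(l < r) U l j * U l j.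
  by rewrite /frob_dot big_ord1; apply: eq_bigr => l _; rewrite !mxE.
by rewrite expr2.
Qed.

(** Balls of the operator norm of [U] acting on rows from the right. Quantifying over the number of
    rows lets products [V *m U] be estimated directly in Frobenius norm. *)
Definition op_ball r N (t : R) (U : 'M[R]_(r, N)) : Prop :=
  forall n (V : 'M[R]_(n, r)), frob_norm (V *m U) <= t * frob_norm V.

Lemma op_ballD r N s t (A B : 'M[R]_(r, N)) :
  op_ball s A -> op_ball t B -> op_ball (s + t) (A + B).
Proof.
move=> hA hB n V; rewrite mulmxDr mulrDl.
by apply: le_trans (frob_normD _ _) _; apply: lerD.
Qed.

Lemma op_ballZ r N c t (A : 'M[R]_(r, N)) :
  op_ball t A -> op_ball (`|c| * t) (c *: A).
Proof. by move=> hA n V; rewrite -scalemxAr frob_normZ -mulrA ler_wpM2l. Qed.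

Lemma le_op_ball r N s t (A : 'M[R]_(r, N)) :
  s <= t -> op_ball s A -> op_ball t A.
Proof.
by move=> st hA n V; apply: le_trans (hA _ _) _; rewrite ler_wpM2r// frob_norm_ge0.
Qed.

Lemma op_ball_entry r N t (A : 'M[R]_(r, N)) i j : op_ball t A -> `|A i j| <= t.
Proof.
move=> /(_ 1%N (delta_mx 0 i)); rewrite -rowE.
have -> : frob_norm (delta_mx 0 i : 'rV[R]_r) = 1.
  rewrite /frob_norm /frob_dot big_ord1 (bigD1 i)//= big1 ?addr0.
    by rewrite mxE !eqxx mulr1 sqrtr1.
  by move=> l li; rewrite mxE (negbTE li) andbF mulr0.
rewrite mulr1; apply: le_trans.
by have := entry_le_frob_norm (row i A) 0 j; rewrite mxE.
Qed.

Lemma op_ball_of_entries r N h (A : 'M[R]_(r, N)) : 0 <= h ->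
  (forall i j, `|A i j| <= h) -> op_ball ((r * N)%:R * h) A.
Proof.
move=> h0 hA n V; apply: le_trans (frob_norm_mulmx V A) _.
by rewrite mulrC ler_wpM2r ?frob_norm_ge0// frob_norm_of_entries.
Qed.

Lemma frob_norm_le_dot n1 N1 n2 N2 (A : 'M[R]_(n1, N1)) (B : 'M[R]_(n2, N2)) :
  (frob_norm A <= frob_norm B) = (frob_dot A A <= frob_dot B B).
Proof. by rewrite ler_sqrt// frob_dot_ge0. Qed.

(* Peel off the orthogonal projection of the rows of [A] onto one unit vector of
   its row space; [U] keeps orthogonal rows of norm at most one. *)
Lemma lowrank_factor r n N (A : 'M[R]_(n, N)) : (\rank A <= r)%N ->
  exists (V : 'M[R]_(n, r)) (U : 'M[R]_(r, N)),
    [/\ A = V *m U, op_ball 1 U & frob_norm V <= frob_norm A].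
Proof.
elim: r n A => [|r IHr] n A rA.
  have A0 : A = 0 by apply/eqP; rewrite -mxrank_eq0 -leqn0.
  exists 0, 0; split; rewrite ?mulmx0// ?frob_norm0 ?frob_norm_ge0//.
  by move=> k V; rewrite mulmx0 frob_norm0 mul1r frob_norm_ge0.
have [A0|/rowV0Pn[a0 a0A a00]] := eqVneq A 0.
  exists 0, 0; split; rewrite ?mulmx0// ?frob_norm0 ?frob_norm_ge0//.
  by move=> k V; rewrite mulmx0 frob_norm0 mul1r frob_norm_ge0.
pose u : 'rV[R]_N := (frob_norm a0)^-1 *: a0.
have na0 : frob_norm a0 != 0.
  apply: contra_neq a00 => e; apply: frob_dot_eq0.
  by rewrite -sqr_frob_norm e expr0n.
have uu : u *m u^T = 1%:M.
  rewrite [LHS]mx11_scalar; congr (_%:M).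
  have -> : (u *m u^T) 0 0 = \tr (u *m u^T) by rewrite /mxtrace big_ord1.
  rewrite -frob_dotE -sqr_frob_norm frob_normZ normfV ger0_norm ?frob_norm_ge0//.
  by rewrite mulVf// expr1n.
(* Orthogonal projection onto the complement of [u]; [A *m Q] is what is left after peeling. *)
pose Q : 'M[R]_N := 1%:M - u^T *m u.
have uQ : u *m Q = 0 by rewrite mulmxBr mulmx1 mulmxA uu mul1mx subrr.
have Qu : Q *m u^T = 0 by rewrite mulmxBl mul1mx -mulmxA uu mulmx1 subrr.
have QT : Q^T = Q by rewrite raddfB/= trmx1 trmx_mul trmxK.
have QQ : Q *m Q = Q by rewrite {1}/Q mulmxBl mul1mx -mulmxA uQ mulmx0 subr0.
have pyth k (B : 'M[R]_(k, N)) :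
    frob_dot B B = frob_dot (B *m u^T) (B *m u^T) + frob_dot (B *m Q) (B *m Q).
  rewrite !frob_dotE !trmx_mul trmxK QT !mulmxA -[B *m Q *m Q]mulmxA QQ.
  by rewrite -raddfD/= -mulmxDl -[B *m u^T *m u]mulmxA -mulmxDr subrKC mulmx1.
have u0 : u != 0 by rewrite scaler_eq0 negb_or invr_eq0 na0.
(* [u] lies both in the row space of [A] and in the kernel of [Q], so rank-nullity makes the rank
   drop. *)
have rAQ : (\rank (A *m Q) <= r)%N.
  rewrite -ltnS (leq_trans _ rA)// -(mxrank_mul_ker A Q).
  rewrite -[X in (X <= _)%N]addn1 leq_add2l.
  have uA : (u <= A :&: kermx Q)%MS.
    by rewrite sub_capmx scalemx_sub//=; apply/sub_kermxP.
  by apply: leq_trans (mxrankS uA); rewrite rank_rV u0.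
have [V' [U' [AQE U'1 V'A]]] := IHr _ _ rAQ.
(* [U' *m Q] replaces [U'] to make the remaining rows orthogonal to [u]; the product with [V'] is
   unchanged because [Q] is idempotent. *)
exists (row_mx (A *m u^T) V' : 'M[R]_(n, 1 + r)), (col_mx u (U' *m Q) : 'M[R]_(1 + r, N)).
split.
- rewrite (@mul_row_col _ n 1 r N) [V' *m _]mulmxA -AQE -[A *m Q *m Q]mulmxA QQ.
  by rewrite -[A *m _ *m u]mulmxA -mulmxDr subrKC mulmx1.
- move=> k W; rewrite mul1r frob_norm_le_dot.
  rewrite -[W](@hsubmxK _ k 1 r) (@mul_row_col _ k 1 r N).
  set w : 'M[R]_(k, 1) := lsubmx _; set W' : 'M[R]_(k, r) := rsubmx _.
  rewrite [leRHS](@frob_dot_row_mx k 1 r) pyth mulmxDl mulmxDl.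
  rewrite -[w *m u *m u^T]mulmxA uu mulmx1 -!mulmxA Qu uQ QQ !mulmx0 addr0 add0r.
  rewrite lerD2l; apply: (@le_trans _ _ (frob_dot (W' *m U') (W' *m U'))).
    by rewrite [leRHS]pyth mulmxA lerDr frob_dot_ge0.
  by rewrite -frob_norm_le_dot; have := U'1 _ W'; rewrite mul1r.
- rewrite !frob_norm_le_dot [leRHS]pyth (@frob_dot_row_mx n 1 r) lerD2l.
  by rewrite -frob_norm_le_dot.
Qed.

End Frobenius.

(** * From a net to all low-rank matrices *)

Section RipOfNet.
Context (R : realType) (n N r : nat) (nu : 'M[R]_(n, N) -> R).
Hypothesis nu_ge0 : forall A, 0 <= nu A.
Hypothesis nuD : forall A B, nu (A + B) <= nu A + nu B.
Hypothesis nuZ : forall c A, nu (c *: A) = `|c| * nu A.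
Variable K0 : R.
Hypothesis nu_bounded : forall A, nu A <= K0 * frob_norm A.

Lemma ler_of_sqr (a b : R) : 0 <= b -> a ^+ 2 <= b ^+ 2 -> a <= b.
Proof.
move=> b0 ab; rewrite leNgt; apply/negP => ba.
move: ab; rewrite leNgt => /negP; apply; rewrite ltr_pXn2r ?nnegrE//.
by rewrite ltW// (le_lt_trans b0).
Qed.

(** The norm of [nu] restricted to low-rank matrices. Its finiteness, supplied by [nu_bounded],
    permits absorbing a small multiple of it into the left-hand side. *)
Definition lowrank_sup : R := sup [set nu A | A in
  [set A : 'M[R]_(n, N) | (\rank A <= r)%N /\ frob_norm A <= 1]].

Lemma lowrank_has_sup : has_sup [set nu A | A in
  [set A : 'M[R]_(n, N) | (\rank A <= r)%N /\ frob_norm A <= 1]].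
Proof.
split; first by exists (nu 0), 0 => //; rewrite /= mxrank0 frob_norm0.
exists `|K0| => _ [A [_ A1] <-]; apply: le_trans (nu_bounded A) _.
apply: (@le_trans _ _ (`|K0| * frob_norm A)).
  by rewrite ler_wpM2r ?frob_norm_ge0// ler_norm.
by rewrite ler_piMr.
Qed.

Lemma le_lowrank_sup A : (\rank A <= r)%N -> nu A <= lowrank_sup * frob_norm A.
Proof.
move=> rA; have [A0|A0] := eqVneq (frob_norm A) 0.
  by have := nu_bounded A; rewrite A0 !mulr0.
have A0' : 0 < frob_norm A by rewrite lt0r A0 frob_norm_ge0.
rewrite -ler_pdivrMr// mulrC -[(frob_norm A)^-1]ger0_norm ?invr_ge0 ?frob_norm_ge0//.
rewrite -nuZ; apply: sup_upper_bound; first exact: lowrank_has_sup.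
exists ((frob_norm A)^-1 *: A) => //; split.
  by apply: leq_trans rA; apply: mxrankS; exact: scalemx_sub.
by rewrite frob_normZ ger0_norm ?invr_ge0 ?frob_norm_ge0// mulVf.
Qed.

Lemma lowrank_sup_ge0 : 0 <= lowrank_sup.
Proof.
apply: le_trans (nu_ge0 0) _; apply: sup_upper_bound; first exact: lowrank_has_sup.
by exists 0 => //; rewrite /= mxrank0 frob_norm0.
Qed.

Variables (SV : seq 'M[R]_(n, r)) (SU : seq 'M[R]_(r, N)) (rho : R).
Hypotheses (rho_ge0 : 0 <= rho) (rho_le1 : rho <= 1).
Hypothesis SV_net : forall V, frob_norm V <= 1 ->
  exists2 V', V' \in SV & frob_norm (V - V') <= rho.
Hypothesis SU_net : forall U, op_ball 1 U ->
  exists2 U', U' \in SU & op_ball rho (U - U').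

Lemma rank_mulmx_le k l (V : 'M[R]_(k, r)) (U : 'M[R]_(r, l)) : (\rank (V *m U) <= r)%N.
Proof. exact: leq_trans (mxrankM_maxl V U) (rank_leq_col V). Qed.

Lemma nuN A : nu (- A) = nu A.
Proof. by rewrite -scaleN1r nuZ normrN1 mul1r. Qed.

Lemma lowrank_net A : (\rank A <= r)%N -> frob_norm A <= 1 ->
  exists V U, [/\ V \in SV, U \in SU,
    `|frob_norm A - frob_norm (V *m U)| <= 3 * rho &
    `|nu A - nu (V *m U)| <= 3 * rho * lowrank_sup].
Proof.
move=> rA A1; have [V [U [AE U1 VA]]] := lowrank_factor rA.
have [V' SV' VV'] := SV_net (le_trans VA A1).
have [U' SU' UU'] := SU_net U1.
exists V', U'; set D1 := V' *m (U - U'); set D2 := (V - V') *m U.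
have nV' : frob_norm V' <= 1 + rho.
  rewrite -[V'](subKr V); apply: le_trans (frob_normD _ _) _.
  by rewrite frob_normN lerD// (le_trans VA).
(* The factor two bounds [1 + rho], since [V'] is only close to the unit ball. *)
have d1 : frob_norm D1 <= 2 * rho.
  apply: le_trans (UU' _ _) _; rewrite mulrC ler_wpM2r//.
  by apply: le_trans nV' _; rewrite -[2]/(1 + 1) lerD2l.
have d2 : frob_norm D2 <= rho.
  by apply: le_trans (U1 _ _) _; rewrite mul1r.
have AD : A = V' *m U' + (D1 + D2).
  by rewrite AE /D1 /D2 mulmxBr mulmxBl addrA subrKC subrKC.
have nD : frob_norm (D1 + D2) <= 3 * rho.
  by apply: le_trans (frob_normD _ _) _; lra.
(* The sum may have rank up to [2r], so it is split before the supremum over rank [r] is applied to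
   each term. *)
have nuDD : nu (D1 + D2) <= 3 * rho * lowrank_sup.
  apply: le_trans (nuD _ _) _.
  have := le_lowrank_sup (rank_mulmx_le V' (U - U')).
  have := le_lowrank_sup (rank_mulmx_le (V - V') U).
  rewrite -/D1 -/D2; have := lowrank_sup_ge0; nra.
have dist (f : 'M[R]_(n, N) -> R) b : (forall B C, f (B + C) <= f B + f C) ->
    (forall B, f (- B) = f B) -> f (D1 + D2) <= b -> `|f A - f (V' *m U')| <= b.
  move=> fD fN fb; rewrite ler_norml; apply/andP; split.
    have : f (V' *m U') <= f A + f (- (D1 + D2)).
      by rewrite -{1}[V' *m U'](addrK (D1 + D2)) -AD fD.
    by rewrite fN; lra.
  by have := fD (V' *m U') (D1 + D2); rewrite -AD; lra.
split=> //; first by apply: dist => //; [exact: frob_normD|exact: frob_normN].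
by apply: dist => //; exact: nuN.
Qed.

(** Since [3 * rho <= delta / 16], the inequality [K <= (1 + delta / 8) * (1 + 3 * rho) + 3 * rho *
    K] gives [K <= 1 + 3 * delta / 8], whose square is at most [1 + delta]. Inserting this [K] in
    the lower net estimate gives [1 - delta / 2], whose square is at least [1 - delta]. *)
Lemma rip_of_net (delta : R) : 0 < delta -> delta < 1 -> rho <= delta / 48 ->
  (forall V U, V \in SV -> U \in SU ->
    (1 - delta / 8) * frob_norm (V *m U) ^+ 2 <= nu (V *m U) ^+ 2 /\
    nu (V *m U) ^+ 2 <= (1 + delta / 8) * frob_norm (V *m U) ^+ 2) ->
  forall A, (\rank A <= r)%N ->
    (1 - delta) * frob_norm A ^+ 2 <= nu A ^+ 2 /\
    nu A ^+ 2 <= (1 + delta) * frob_norm A ^+ 2.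
Proof.
move=> d0 d1 hrho hnet; set K := lowrank_sup; have Kge0 : 0 <= K := lowrank_sup_ge0.
have net1 V U : V \in SV -> U \in SU ->
    (1 - delta / 8) * frob_norm (V *m U) <= nu (V *m U) /\
    nu (V *m U) <= (1 + delta / 8) * frob_norm (V *m U).
  move=> SVV SUU; have [h1 h2] := hnet V U SVV SUU.
  have f0 := frob_norm_ge0 (V *m U); have f2 := sqr_ge0 (frob_norm (V *m U)).
  split; apply: ler_of_sqr; rewrite ?nu_ge0//; last 2 first.
  - by rewrite mulr_ge0//; lra.
  - by apply: le_trans h2 _; rewrite exprMn ler_wpM2r//; nra.
  - by apply: le_trans h1; rewrite exprMn ler_wpM2r//; nra.
have Kub : K <= 1 + 3 * delta / 8.
  have : K <= (1 + delta / 8) * (1 + 3 * rho) + 3 * rho * K.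
    apply: ge_sup; first by have [] := lowrank_has_sup.
    move=> _ [A [rA A1] <-].
    have [V [U [SVV SUU]]] := lowrank_net rA A1.
    rewrite !ler_norml => /andP[h1 h2] /andP[h3 h4].
    have [_ h5] := net1 V U SVV SUU.
    by rewrite -/K in h3 h4; nra.
  by nra.
have unit A : (\rank A <= r)%N -> frob_norm A = 1 -> 1 - delta / 2 <= nu A.
  move=> rA A1; have A1' : frob_norm A <= 1 by rewrite A1.
  have [V [U [SVV SUU]]] := lowrank_net rA A1'.
  rewrite A1 !ler_norml -/K => /andP[h1 h2] /andP[h3 h4].
  have [h5 _] := net1 V U SVV SUU.
  have h6 : (1 - delta / 8) * (1 - 3 * rho) <= nu (V *m U).
    by apply: le_trans h5; apply: ler_wpM2l; lra.
  have h7 : 3 * rho * K <= delta / 16 * (1 + 3 * delta / 8) by apply: ler_pM; lra.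
  nra.
move=> A rA; have f0 := frob_norm_ge0 A; have f2 := sqr_ge0 (frob_norm A).
split; last first.
  have h : nu A <= (1 + 3 * delta / 8) * frob_norm A.
    by apply: le_trans (le_lowrank_sup rA) _; rewrite ler_wpM2r.
  apply: (@le_trans _ _ (((1 + 3 * delta / 8) * frob_norm A) ^+ 2)).
    by rewrite lerXn2r ?nnegrE// mulr_ge0//; lra.
  by rewrite exprMn ler_wpM2r//; nra.
have h : (1 - delta / 2) * frob_norm A <= nu A.
  have [A0|A0] := eqVneq (frob_norm A) 0; first by rewrite A0 mulr0.
  have Ap : 0 < frob_norm A by rewrite lt0r A0.
  have := unit ((frob_norm A)^-1 *: A).
  rewrite frob_normZ nuZ ger0_norm ?invr_ge0// mulVf// => /(_ _ erefl) h.
  rewrite -ler_pdivlMr// [nu A / _]mulrC; apply: h.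
  by apply: leq_trans rA; apply: mxrankS; exact: scalemx_sub.
apply: (@le_trans _ _ (((1 - delta / 2) * frob_norm A) ^+ 2)).
  by rewrite exprMn ler_wpM2r//; nra.
by rewrite lerXn2r ?nnegrE// mulr_ge0//; lra.
Qed.

End RipOfNet.

(** * The Gaussian map *)

Section GroupedGaussians.
Local Open Scope ereal_scope.
Context d (T : measurableType d) (R : realType) (P : probability T R)
  (J I : finType) (Y : J -> I -> T -> R) (a : I -> R).
Hypothesis mY : forall j i, measurable_fun setT (Y j i).
Hypothesis indepY : forall B : J -> I -> set R,
  (forall j i, measurable (B j i)) ->
  P (\bigcap_j \bigcap_i (Y j i @^-1` B j i)) =
  \prod_j \prod_i P (Y j i @^-1` B j i).

Definition lin_comb (j : J) (w : T) : R := (\sum_i a i * Y j i w)%R.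

(** Intersection-stable generators of the information carried by group [j], in the form required by
    the extension of independence. *)
Definition cylinders (j : J) : set (set T) :=
  [set D | exists2 B : I -> set R, (forall i, measurable (B i)) &
                                   D = \bigcap_i (Y j i @^-1` B i)].

Lemma measurable_preimage j i B : measurable B -> measurable (Y j i @^-1` B).
Proof. by move=> mB; rewrite -[_ @^-1` _]setTI; exact: mY. Qed.

Lemma measurable_cylinder (j : J) (B : I -> set R) : (forall i, measurable (B i)) ->
  measurable (\bigcap_i (Y j i @^-1` B i)).
Proof.
by move=> mB; apply: bigcap_finType_measurable => i; exact: measurable_preimage.
Qed.

(** The other groups are padded with [setT], whose factors equal one. *)
Lemma probability_cylinder j (B : I -> set R) : (forall i, measurable (B i)) ->
  P (\bigcap_i (Y j i @^-1` B i)) = \prod_i P (Y j i @^-1` B i).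
Proof.
move=> mB; pose C j' i := if j' == j then B i else setT.
have Cj i : C j i = B i by rewrite /C eqxx.
have C0 j' i : j' != j -> C j' i = setT by rewrite /C => /negbTE ->.
transitivity (P (\bigcap_j' \bigcap_i (Y j' i @^-1` C j' i))).
  congr (P _); apply/seteqP; split=> [w Bw j' _ i _|w Cw i _].
    by have [->|/C0] := eqVneq j' j; rewrite /preimage/= ?Cj; [exact: Bw|move=> ->].
  by have := Cw j Logic.I i Logic.I; rewrite /preimage/= Cj.
rewrite indepY; last by move=> j' i; rewrite /C; case: ifP.
rewrite (bigD1 j)//= [X in _ * X]big1 ?mule1.
  by apply: eq_bigr => i _; rewrite Cj.
move=> j' j'j; apply: big1 => i _.
by rewrite C0// preimage_setT; exact: probability_setT.
Qed.

Lemma measurable_lin_comb j : measurable_fun setT (lin_comb j).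
Proof. by apply: measurable_sum => i; exact: measurable_funM. Qed.

(** [T] is re-equipped with the sigma-algebra generated by the cylinders, for which each [Y j i] is
    measurable by construction; closure under finite sums does the rest. *)
Lemma lin_comb_cylinder_measurable j (S : set R) : measurable S ->
  <<s cylinders j >> (lin_comb j @^-1` S).
Proof.
move=> mS.
have mYj i : measurable_fun [set: g_sigma_algebraType (cylinders j)] (Y j i).
  move=> _ B mB; rewrite setTI; apply: sub_gen_smallest.
  exists (fun i' => if i' == i then B else setT); first by move=> i'; case: ifP.
  apply/seteqP; split=> [w Bw i' _|w /(_ i Logic.I)]; last by rewrite eqxx.
  by case: eqVneq => [->|].
have mg : measurable_fun [set: g_sigma_algebraType (cylinders j)] (lin_comb j).
  by apply: measurable_sum => i; exact: measurable_funM.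
by have := mg measurableT _ mS; rewrite setTI.
Qed.

Lemma independent_lin_comb (B : J -> set R) : (forall j, measurable (B j)) ->
  P (\bigcap_j (lin_comb j @^-1` B j)) = \prod_j P (lin_comb j @^-1` B j).
Proof.
move=> mB; apply: (independent_sigma_algebras (G := cylinders)).
- by move=> j _ [C mC ->]; exact: measurable_cylinder.
- move=> j _ _ [C mC ->] [D mD ->]; exists (fun i => C i `&` D i).
    by move=> i; exact: measurableI.
  by rewrite -bigcapI.
- by move=> j; exists (fun=> setT) => //; apply/seteqP; split.
- move=> D GD.
  have /choice[C CP] : forall j, exists C : I -> set R,
      (forall i, measurable (C i)) /\ D j = \bigcap_i (Y j i @^-1` C i).
    by move=> j; have [C] := GD j; exists C.
  under eq_bigcapr => j _ do rewrite (CP j).2.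
  rewrite indepY; last by move=> j; exact: (CP j).1.
  by apply: eq_bigr => j _; rewrite (CP j).2 probability_cylinder//; exact: (CP j).1.
- by move=> j; exact: lin_comb_cylinder_measurable.
Qed.

(** Independence makes the exponents [(lam * a i) ^ 2 / 2] add up, so coefficients of unit length
    preserve the Gaussian moment generating function. *)
Lemma mgf_lin_comb (lam : R) j :
  (forall i (mu : R), \int[P]_w (expR (mu * Y j i w))%:E = (expR (mu ^+ 2 / 2))%:E) ->
  (\sum_i a i ^+ 2)%R = 1%R ->
  \int[P]_w (expR (lam * lin_comb j w))%:E = (expR (lam ^+ 2 / 2))%:E.
Proof.
move=> mgfY a1.
under eq_integral do rewrite mulr_sumr expR_sum.
rewrite (integral_prod_independent (X := Y j)
  (f := fun i x => expR (lam * (a i * x)))).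
- under eq_bigr => i _.
    under eq_integral do rewrite mulrA.
    rewrite mgfY; over.
  rewrite prodEFin -expR_sum; congr (expR _)%:E.
  under eq_bigr do rewrite exprMn mulrAC mulrC.
  by rewrite -mulr_suml a1 mul1r.
- exact: mY.
- exact: probability_cylinder.
- move=> i; apply: measurableT_comp => //.
  by apply: measurable_funM => //; exact: measurable_funM.
- by move=> i x; exact: expR_ge0.
- by move=> i; under eq_integral do rewrite mulrA; rewrite mgfY ltry.
Qed.

End GroupedGaussians.

(** * Near-isometry as a closed condition tested on a countable family *)

Section RipClosed.
Context (R : realType) (n N r : nat) (nu : 'M[R]_(n, N) -> R).
Hypothesis nu_ge0 : forall A, 0 <= nu A.
Hypothesis nuD : forall A B, nu (A + B) <= nu A + nu B.
Hypothesis nuZ : forall c A, nu (c *: A) = `|c| * nu A.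
Variable K0 : R.
Hypothesis K0_ge0 : 0 <= K0.
Hypothesis nu_bounded : forall A, nu A <= K0 * frob_norm A.
Variable delta : R.
Hypotheses (delta_ge0 : 0 <= delta) (delta_le1 : delta <= 1).

Definition near_isometric A : Prop :=
  (1 - delta) * frob_norm A ^+ 2 <= nu A ^+ 2 /\
  nu A ^+ 2 <= (1 + delta) * frob_norm A ^+ 2.

Lemma near_isometricZ c A : near_isometric A -> near_isometric (c *: A).
Proof.
move=> [h1 h2]; rewrite /near_isometric frob_normZ nuZ !exprMn.
by split; [rewrite [leLHS]mulrCA|rewrite [leRHS]mulrCA]; rewrite ler_wpM2l// sqr_ge0.
Qed.

(** Square roots, legitimate for [0 <= delta <= 1], turn the condition into inequalities between
    Lipschitz functions of [A], convenient for passing to the limit. *)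
Lemma near_isometric_sqrtP A : near_isometric A <->
  Num.sqrt (1 - delta) * frob_norm A <= nu A /\
  nu A <= Num.sqrt (1 + delta) * frob_norm A.
Proof.
have s1 : Num.sqrt (1 - delta) ^+ 2 = 1 - delta by rewrite sqr_sqrtr ?subr_ge0.
have s2 : Num.sqrt (1 + delta) ^+ 2 = 1 + delta by rewrite sqr_sqrtr ?addr_ge0.
have f0 := frob_norm_ge0 A.
rewrite /near_isometric -{1}s1 -{1}s2 -!exprMn; split=> -[h1 h2]; split.
- by apply: ler_of_sqr => //.
- by apply: ler_of_sqr => //; rewrite mulr_ge0// sqrtr_ge0.
- by rewrite lerXn2r ?nnegrE// mulr_ge0// sqrtr_ge0.
- by rewrite lerXn2r ?nnegrE// mulr_ge0// sqrtr_ge0.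
Qed.

Lemma near_isometric_closed A :
  (forall e, 0 < e -> exists2 B, frob_norm (A - B) <= e & near_isometric B) ->
  near_isometric A.
Proof.
move=> hA; apply/near_isometric_sqrtP.
set s1 := Num.sqrt (1 - delta); set s2 := Num.sqrt (1 + delta).
have s10 : 0 <= s1 by exact: sqrtr_ge0.
have s20 : 0 <= s2 by exact: sqrtr_ge0.
(* [K0], [s1] and [s2] are the Lipschitz constants of the compared quantities; the added [1] makes
   [L] positive. *)
pose L := K0 + s1 + s2 + 1; have L0 : 0 < L by rewrite /L; have := K0_ge0; lra.
have approx e : 0 < e -> exists B, [/\ near_isometric B,
    (K0 + s1 + s2) * frob_norm (A - B) <= e,
    frob_norm A <= frob_norm B + frob_norm (A - B),
    frob_norm B <= frob_norm A + frob_norm (A - B) &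
    nu A <= nu B + K0 * frob_norm (A - B) /\ nu B <= nu A + K0 * frob_norm (A - B)].
  move=> e0; have [B hB BP] := hA (e / L) (divr_gt0 e0 L0).
  have AB : A = B + (A - B) by rewrite subrKC.
  have BA : B = A + - (A - B) by rewrite subKr.
  exists B; split => //.
  - have : L * frob_norm (A - B) <= e by rewrite mulrC -ler_pdivlMr.
    by have := frob_norm_ge0 (A - B); rewrite /L; lra.
  - by rewrite {1}AB; exact: frob_normD.
  - by rewrite {1}BA (le_trans (frob_normD _ _))// frob_normN.
  - split.
      by rewrite {1}AB (le_trans (nuD _ _))// lerD2l.
    rewrite {1}BA (le_trans (nuD _ _))// lerD2l -scaleN1r nuZ normrN1 mul1r.
    exact: nu_bounded.
split; apply/ler_addgt0Pr => e e0.
- have [B [/near_isometric_sqrtP[h1 _] h2 h3 _ [_ h4]]] := approx e e0.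
  rewrite -/s1 in h1; have := frob_norm_ge0 (A - B).
  by have := ler_wpM2l s10 h3; have := K0_ge0; nra.
- have [B [/near_isometric_sqrtP[_ h1] h2 _ h3 [h4 _]]] := approx e e0.
  rewrite -/s2 in h1; have := frob_norm_ge0 (A - B).
  by have := ler_wpM2l s20 h3; have := K0_ge0; nra.
Qed.

Lemma scaled_lattice_approx p q (V : 'M[R]_(p, q)) (k : nat) :
  exists Z : 'M[int]_(p, q), forall i j,
    `|(V - k.+1%:R^-1 *: rmx R Z) i j| <= k.+1%:R^-1.
Proof.
exists (map_mx Num.floor (k.+1%:R *: V)) => i j; rewrite !mxE.
have /andP[h1 h2] := floor_itv (k.+1%:R * V i j).
have k0 : 0 < k.+1%:R :> R by rewrite ltr0n.
rewrite -[X in `|X - _|](mulKf (lt0r_neq0 k0)) -mulrBr normrM.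
have -> : `|k.+1%:R^-1| = k.+1%:R^-1 :> R by rewrite ger0_norm// invr_ge0.
rewrite -[X in _ <= X]mulr1; apply: ler_wpM2l; first by rewrite invr_ge0.
by rewrite ler_norml; move: h2; rewrite intrD; lra.
Qed.

(** The two factors are rounded, and not [A], so that the approximant keeps rank at most [r]. The
    common denominators form the scalar [c]. *)
Lemma lowrank_lattice_approx (A : 'M[R]_(n, N)) (e : R) : (\rank A <= r)%N -> 0 < e ->
  exists c (Z1 : 'M[int]_(n, r)) (Z2 : 'M[int]_(r, N)),
    frob_norm (A - c *: (rmx R Z1 *m rmx R Z2)) <= e.
Proof.
move=> rA e0; have [V [U [AE U1 _]]] := lowrank_factor rA.
(* [h * D] is the total error for mesh [h]: that of [U] seen through [V], plus that of [V] seen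
   through the rounded [U'], whose operator norm is at most [1 + r * N]. *)
pose D := (r * N)%:R * frob_norm V + (n * r)%:R * (1 + (r * N)%:R).
have fV := frob_norm_ge0 V.
have D0 : 0 <= D by rewrite /D !addr_ge0// !mulr_ge0// addr_ge0.
pose k := Num.bound (D / e); pose h : R := k.+1%:R^-1.
have h0 : 0 < h by rewrite invr_gt0.
have h1 : h <= 1 by rewrite invf_le1// ler1n.
have hD : h * D <= e.
  rewrite /h mulrC ler_pdivrMr// mulrC -ler_pdivrMr//.
  apply: le_trans (ler_norm _) _; apply: le_trans (ltW (unstable.ltr_norm_bound _)) _.
  by rewrite ler_nat leqnSn.
have [Z1 hZ1] := scaled_lattice_approx V k.
have [Z2 hZ2] := scaled_lattice_approx U k.
exists (h * h), Z1, Z2.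
set V' := h *: rmx R Z1; set U' := h *: rmx R Z2.
have -> : (h * h) *: (rmx R Z1 *m rmx R Z2) = V' *m U'.
  by rewrite /V' /U' -scalemxAl -scalemxAr scalerA.
have -> : A - V' *m U' = V *m (U - U') + (V - V') *m U'.
  by rewrite AE mulmxBr mulmxBl addrA subrK.
have bU : op_ball ((r * N)%:R * h) (U - U').
  by apply: op_ball_of_entries => //; exact: ltW.
have bV : frob_norm (V - V') <= (n * r)%:R * h.
  by apply: frob_norm_of_entries => //; exact: ltW.
have bU' : op_ball (1 + (r * N)%:R) U'.
  rewrite -[U'](subKr U); apply: op_ballD => //.
  rewrite -scaleN1r -[_%:R]mul1r -{1}(normrN1 R); apply: op_ballZ.
  by apply: le_op_ball bU; rewrite ler_piMr.
apply: le_trans (frob_normD _ _) _; apply: le_trans hD.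
have := bU _ V; have := bU' _ (V - V'); rewrite /D.
have : (1 + (r * N)%:R) * frob_norm (V - V') <= (1 + (r * N)%:R) * ((n * r)%:R * h).
  by rewrite ler_wpM2l// addr_ge0.
lra.
Qed.

(** Homogeneity removes the real scalar of the approximants, so countably many integer pairs decide
    the condition; this is the source of the measurability of the good event. *)
Lemma near_isometric_of_lattice :
  (forall (Z1 : 'M[int]_(n, r)) (Z2 : 'M[int]_(r, N)),
    near_isometric (rmx R Z1 *m rmx R Z2)) ->
  forall A, (\rank A <= r)%N -> near_isometric A.
Proof.
move=> hZ A rA; apply: near_isometric_closed => e e0.
have [c [Z1 [Z2 h]]] := lowrank_lattice_approx rA e0.
by exists (c *: (rmx R Z1 *m rmx R Z2)) => //; exact: near_isometricZ.
Qed.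

End RipClosed.

(** * Probabilistic tools: countable intersections, transport of the normal law, union bound *)

Lemma countable_bigcap_measurable d (T : measurableType d) (I : countType)
    (F : I -> set T) : (forall i, measurable (F i)) -> measurable (\bigcap_i F i).
Proof.
move=> mF; rewrite (_ : \bigcap_i F i =
    \bigcap_(k : nat) (if unpickle k is Some i then F i else setT)).
  apply: bigcapT_measurable => k; by case: unpickle.
apply/seteqP; split=> [w Fw k _|w Fw i _].
  by case: unpickle => // i; exact: Fw.
by have := Fw (pickle i) Logic.I; rewrite pickleK.
Qed.

(** [standard_normal] equates laws on Borel sets; the passage to exponentials is the comparison of
    weighted laws with weight one. *)
Lemma standard_normal_mgf (R : realType) d (T : measurableType d)
    (P : probability T R) (X : {RV P >-> R}) (lam : R) : standard_normal X ->
  (\int[P]_w (expR (lam * X w))%:E = (expR (lam ^+ 2 / 2))%:E)%E.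
Proof.
move=> nX; rewrite -normal_prob_mgf.
transitivity (\int[P]_w (cst 1 w * expR (lam * X w))%:E)%E.
  by apply: eq_integral => w _; rewrite mul1r.
transitivity (\int[normal_prob 0 1]_x (cst 1 x * expR (lam * x))%:E)%E; last first.
  by apply: eq_integral => w _; rewrite mul1r.
have indicE' B : measurable B ->
    (\int[P]_w (cst 1 w * \1_B (X w))%:E =
     \int[normal_prob 0 1]_x (cst 1 x * \1_B x)%:E)%E.
  move=> mB; have mXB : measurable (X @^-1` B).
    by rewrite -[_ @^-1` _]setTI; exact: measurable_funPT.
  transitivity (P (X @^-1` B)).
    rewrite -[in RHS](setIT (_ @^-1` _)) -integral_indic//.
    by apply: eq_integral => w _; rewrite mul1r.
  transitivity (normal_prob 0 1 B); first exact: nX.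
  rewrite -[in LHS](setIT B) -integral_indic//.
  by apply: eq_integral => x _; rewrite mul1r.
apply: (@eq_integral_weight_comp R _ _ _ _ _ _ P (normal_prob 0 1) (cst 1) (cst 1)
  X idfun _ _ _ _ _ _ indicE' (fun x => expR (lam * x))) => //=.
- exact: measurable_id.
- by apply: measurableT_comp => //; exact: measurable_funM.
Qed.

Lemma union_bound (R : realType) d (T : measurableType d) (P : probability T R)
    (I : eqType) (s : seq I) (F : I -> set T) (b : R) :
  (forall x, measurable (F x)) -> (forall x, x \in s -> (P (F x) <= b%:E)%E) ->
  measurable [set w | exists2 x, x \in s & F x w] /\
  (P [set w | exists2 x, x \in s & F x w] <= ((size s)%:R * b)%:E)%E.
Proof.
move=> mF; elim: s => [|x s IHs] hF.
  rewrite (_ : [set w | _] = set0); last by apply/seteqP; split=> w // -[].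
  by rewrite measure0 mul0r.
have -> : [set w | exists2 y, y \in x :: s & F y w] =
    F x `|` [set w | exists2 y, y \in s & F y w].
  apply/seteqP; split=> [w [y]|w [Fx|[y ys Fy]]].
  - by rewrite inE => /predU1P[->|ys] Fy; [left|right; exists y].
  - by exists x; rewrite ?mem_head.
  - by exists y; rewrite // inE ys orbT.
have [|mU hU] := IHs; first by move=> y ys; apply: hF; rewrite inE ys orbT.
split; first exact: measurableU.
apply: (le_trans (measureU2 P (mF x) mU)).
rewrite -natr1 mulrDl mul1r addrC EFinD leeD//.
by apply: hF; rewrite mem_head.
Qed.

(** * The measurement map and its concentration at one matrix *)

Section MeasurementMap.
Context (R : realType) (n N m : nat) (M : 'I_m -> 'M[R]_(n, N)).

Definition meas_map (A : 'M[R]_(n, N)) : 'rV[R]_m := \row_j frob_dot (M j) A.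

Lemma sqr_l2_norm (x : 'rV[R]_m) : l2_norm x ^+ 2 = \sum_(j < m) x 0 j ^+ 2.
Proof. by rewrite sqr_sqrtr// sumr_ge0// => j _; rewrite sqr_ge0. Qed.

Lemma l2_normE (x : 'rV[R]_m) : l2_norm x = frob_norm x.
Proof.
by rewrite /frob_norm /frob_dot big_ord1.
Qed.

Lemma meas_map_normD A B :
  l2_norm (meas_map (A + B)) <= l2_norm (meas_map A) + l2_norm (meas_map B).
Proof.
have -> : meas_map (A + B) = meas_map A + meas_map B.
  by apply/rowP => j; rewrite !mxE frob_dotDr.
by rewrite !l2_normE frob_normD.
Qed.

Lemma meas_map_normZ c A : l2_norm (meas_map (c *: A)) = `|c| * l2_norm (meas_map A).
Proof.
have -> : meas_map (c *: A) = c *: meas_map A.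
  by apply/rowP => j; rewrite !mxE frob_dotZr.
by rewrite !l2_normE frob_normZ.
Qed.

(** A crude bound for fixed measurement matrices, hence random in the application. It makes
    [lowrank_sup] finite and the closedness argument work; its size does not enter the probability
    estimate. *)
Definition meas_map_bound : R := (1 * m)%:R * \sum_j frob_norm (M j).

Lemma meas_map_bound_ge0 : 0 <= meas_map_bound.
Proof. by rewrite mulr_ge0// sumr_ge0// => j _; exact: frob_norm_ge0. Qed.

Lemma meas_map_bounded A : l2_norm (meas_map A) <= meas_map_bound * frob_norm A.
Proof.
rewrite l2_normE -mulrA; apply: frob_norm_of_entries.
  by rewrite mulr_ge0 ?frob_norm_ge0// sumr_ge0// => j _; exact: frob_norm_ge0.
move=> i j; rewrite mxE; apply: (@le_trans _ _ (frob_norm (M j) * frob_norm A)).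
  rewrite ler_norml frob_dot_le_norm andbT lerNl -[X in X * _]frob_normN.
  by rewrite -mulN1r -frob_dotZl scaleN1r frob_dot_le_norm.
rewrite ler_wpM2r ?frob_norm_ge0// (bigD1 j)//= lerDl sumr_ge0// => l _.
exact: frob_norm_ge0.
Qed.

End MeasurementMap.

Section GaussianMap.
Context (R : realType) d (T : measurableType d) (P : probability T R)
  (n N m : nat) (omega : 'I_m * 'I_n * 'I_N -> {RV P >-> R}).
Hypothesis indep_omega : mutually_independent omega.
Hypothesis normal_omega : forall i, standard_normal (omega i).

Definition gauss_mx (w : T) (j : 'I_m) : 'M[R]_(n, N) :=
  \matrix_(k < n, l < N) ((Num.sqrt m%:R)^-1 * omega (j, k, l) w).

Definition entry_rv (j : 'I_m) (p : 'I_n * 'I_N) : T -> R := omega (j, p.1, p.2).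

Lemma measurable_entry_rv j p : measurable_fun setT (entry_rv j p).
Proof. by []. Qed.

(** Regroups the triple index as [j] and a pair [(k, l)], because coordinate [j] of the map depends
    on group [j] alone. *)
Lemma independent_entry_rv (B : 'I_m -> 'I_n * 'I_N -> set R) :
  (forall j p, measurable (B j p)) ->
  (P (\bigcap_j \bigcap_p (entry_rv j p @^-1` B j p)) =
   \prod_j \prod_p P (entry_rv j p @^-1` B j p))%E.
Proof.
move=> mB; have := @indep_omega [set: 'I_m * 'I_n * 'I_N]%SET
  (fun i => B i.1.1 (i.1.2, i.2)) (fun i => mB _ _).
rewrite (_ : [set w | _] = \bigcap_j \bigcap_p (entry_rv j p @^-1` B j p)); last first.
  apply/seteqP; split=> [w Bw j _ [k l] _|w Bw [[j k] l] _].
    exact: (Bw (j, k, l) (finset.in_setT _)).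
  exact: (Bw j Logic.I (k, l) Logic.I).
move=> ->; rewrite pair_bigA/=.
rewrite (reindex (fun q : 'I_m * ('I_n * 'I_N) => (q.1, q.2.1, q.2.2)))/=.
  by apply: eq_big => [q|[j [k l]] _]; rewrite ?inE.
by exists (fun i => (i.1.1, (i.1.2, i.2))) => [[j [k l]]|[[j k] l]].
Qed.

Lemma sqr_meas_map (A : 'M[R]_(n, N)) w :
  l2_norm (meas_map (gauss_mx w) A) ^+ 2 =
  m%:R^-1 * \sum_j lin_comb entry_rv (fun p => A p.1 p.2) j w ^+ 2.
Proof.
rewrite sqr_l2_norm mulr_sumr; apply: eq_bigr => j _.
rewrite mxE -[m%:R^-1](_ : (Num.sqrt m%:R)^-1 ^+ 2 = _); last first.
  by rewrite exprVn sqr_sqrtr.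
rewrite -exprMn; congr (_ ^+ 2); rewrite /frob_dot pair_bigA/= /lin_comb mulr_sumr.
by apply: eq_bigr => -[k l] _; rewrite mxE/= -mulrA [_ * A _ _]mulrC.
Qed.

Lemma measurable_sqr_meas_map (A : 'M[R]_(n, N)) :
  measurable_fun setT (fun w => l2_norm (meas_map (gauss_mx w) A) ^+ 2).
Proof.
under eq_fun do rewrite sqr_meas_map.
apply: measurable_funM => //; apply: measurable_sum => j.
by apply: measurable_funX; exact: measurable_lin_comb.
Qed.

Definition near_iso_event (t : R) (A : 'M[R]_(n, N)) : set T :=
  [set w | near_isometric (fun B => l2_norm (meas_map (gauss_mx w) B)) t A].

Lemma measurable_near_iso_event t A : measurable (near_iso_event t A).
Proof.
rewrite [X in measurable X](_ : _ =
  [set w | (1 - t) * frob_norm A ^+ 2 <= l2_norm (meas_map (gauss_mx w) A) ^+ 2] `&`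
  [set w | l2_norm (meas_map (gauss_mx w) A) ^+ 2 <= (1 + t) * frob_norm A ^+ 2]).
  have mq := measurable_sqr_meas_map A.
  apply: measurableI; rewrite -[X in measurable X]setTI;
    by apply: measurable_fun_le.
by apply/seteqP; split.
Qed.

(** A nonzero [A] is normalised, which gives coefficients of unit length and brings the coordinates
    under the sum-of-squares bound; for [A] of norm zero the event is sure. *)
Lemma near_iso_event_concentration t A : (0 < m)%N -> 0 < t -> t <= 1 ->
  (P (~` near_iso_event t A) <=
   (2 * expR (- (m%:R * (t ^+ 2 / (4 * chi_const R)))))%:E)%E.
Proof.
move=> m0 t0 t1; have m0' : 0 < m%:R :> R by rewrite ltr0n.
have [A0|A0] := eqVneq (frob_norm A) 0.
  have iso w : near_iso_event t A w.
    rewrite /near_iso_event /near_isometric/= A0.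
    have -> : l2_norm (meas_map (gauss_mx w) A) = 0.
      apply/eqP; rewrite eq_le sqrtr_ge0 andbT.
      by rewrite (le_trans (meas_map_bounded _ _))// A0 mulr0.
    by rewrite expr0n/= !mulr0.
  rewrite (_ : ~` _ = set0) ?measure0 ?lee_fin ?mulr_ge0 ?expR_ge0//.
  by apply/seteqP; split=> w //= /(_ (iso w)).
have Ap : 0 < frob_norm A by rewrite lt0r A0 frob_norm_ge0.
pose a p := (frob_norm A)^-1 * A p.1 p.2.
have a1 : \sum_p a p ^+ 2 = 1.
  under eq_bigr do rewrite exprMn.
  rewrite -mulr_sumr exprVn sqr_frob_norm /frob_dot pair_bigA/=.
  under [X in _^-1 * X]eq_bigr do rewrite expr2.
  rewrite mulVf//; apply: contra_neq A0 => e.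
  by apply/eqP; rewrite -sqrf_eq0 sqr_frob_norm /frob_dot pair_bigA/= e.
have mgf p j (lam : R) := @standard_normal_mgf _ _ _ _ _ lam (normal_omega (j, p.1, p.2)).
have := @sum_sqr_concentration _ _ _ P _ (lin_comb entry_rv a)
  (measurable_lin_comb a measurable_entry_rv)
  (independent_lin_comb a measurable_entry_rv independent_entry_rv)
  (fun j lam => mgf_lin_comb measurable_entry_rv independent_entry_rv lam
     (fun p mu => mgf p j mu) a1) t t0 t1.
rewrite card_ord; apply: le_trans.
have lE w j : lin_comb entry_rv (fun p => A p.1 p.2) j w =
    frob_norm A * lin_comb entry_rv a j w.
  rewrite /lin_comb mulr_sumr; apply: eq_bigr => p _.
  by rewrite /a !mulrA mulfV// mul1r.
apply: le_measure; rewrite ?inE.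
- by apply: measurableC; exact: measurable_near_iso_event.
- rewrite (_ : [set w | _] = ~` [set w |
    `|\sum_i lin_comb entry_rv a i w ^+ 2 - m%:R| <= t * m%:R]); last first.
    by apply/seteqP; split=> w /= /negP.
  apply: measurableC; rewrite -[X in measurable X]setTI.
  apply: measurable_fun_le => //; apply: measurableT_comp => //.
  apply: measurable_funB => //; apply: measurable_sum => j.
  by apply: measurable_funX; apply: measurable_lin_comb => i.
move=> w /= nA; apply: contra_notN nA; rewrite ler_norml => /andP[h1 h2].
rewrite /near_iso_event/= /near_isometric/= sqr_meas_map.
under eq_bigr do rewrite lE exprMn.
rewrite -mulr_sumr; set S := \sum_j _ in h1 h2 *.
have -> : m%:R^-1 * (frob_norm A ^+ 2 * S) = frob_norm A ^+ 2 * (S / m%:R).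
  by rewrite mulrCA [m%:R^-1 * S]mulrC.
split; [rewrite [leLHS]mulrC|rewrite [leRHS]mulrC];
    apply: ler_wpM2l; rewrite ?sqr_ge0//.
  by rewrite ler_pdivlMr//; lra.
by rewrite ler_pdivrMr//; lra.
Qed.

End GaussianMap.

(** With [L = ln (2 / eps)], the product [(ln kappa + 1) * (D + L)] dominates [D * ln kappa + L]:
    the first term pays for the [kappa ^ D] points, the second turns the factor [2] into [eps]. *)
Lemma net_cardinality_bound (R : realType) (kappa c eps x y : R) (D : nat) :
  1 <= kappa -> 0 < c -> 0 < eps -> eps < 1 ->
  (ln kappa + 1) / c * (D%:R + ln (2 / eps)) <= x ->
  y <= kappa ^+ D -> y * (2 * expR (- (x * c))) <= eps.
Proof.
move=> k1 c0 e0 e1 hx hy.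
have k0 : 0 < kappa by lra.
have lk0 : 0 <= ln kappa by rewrite ln_ge0.
have e2 : 0 < 2 / eps by rewrite divr_gt0.
have le0 : 0 <= ln (2 / eps) by rewrite ln_ge0// ler_pdivlMr//; lra.
have hxc : D%:R * ln kappa + ln (2 / eps) <= x * c.
  have : (ln kappa + 1) * (D%:R + ln (2 / eps)) <= x * c.
    rewrite -ler_pdivrMr//; apply: le_trans hx.
    by rewrite mulrAC.
  have : 0 <= D%:R :> R by []. nra.
have e0' : 0 <= expR (- (x * c)) by exact: expR_ge0.
apply: (@le_trans _ _ (kappa ^+ D * (2 * expR (- (x * c))))).
  by rewrite ler_wpM2r// mulr_ge0.
rewrite -[kappa in kappa ^+ D](lnK k0) -expRM_natl mulrCA -expRD.
apply: (@le_trans _ _ (2 * expR (- ln (2 / eps)))).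
  by rewrite ler_wpM2l// ler_expR; lra.
by rewrite expRN lnK// invf_div mulrCA mulfV// mulr1.
Qed.

Lemma rank_ric_le (R : realType) n N m r (X : 'M[R]_(n, N) -> 'rV[R]_m) (delta : R) :
  0 <= delta -> rank_rip r X delta -> rank_ric r X <= delta.
Proof.
move=> d0 rip; apply: ge_inf; last by split.
by exists 0 => x [].
Qed.

Theorem theorem2p21 (R : realType) (delta : R) (delta_gt0 : 0 < delta)
    (delta_lt1 : delta < 1) :
  exists C : R, 0 < C /\
    forall (n N m r : nat) (eps : R) (d : measure_display)
      (T : measurableType d) (P : probability T R)
      (X : T -> 'M[R]_(n, N) -> 'rV[R]_m),
      (1 <= r)%N -> (r <= n)%N -> 0 < eps -> eps < 1 ->
      gaussian_information_map P X ->
      C * (r%:R * (n%:R + N%:R) + ln (2 / eps)) <= m%:R ->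
      let good := [set w : T |
        rank_ric r (X w) <= delta /\
        forall A : 'M[R]_(n, N), (\rank A <= r)%N ->
          (1 - delta) * frob_norm A ^+ 2 <= l2_norm (X w A) ^+ 2 /\
          l2_norm (X w A) ^+ 2 <= (1 + delta) * frob_norm A ^+ 2] in
      measurable good /\ ((1 - eps)%:E <= P good)%E.
Proof.
(* The nets have mesh [3 / k], which must be at most [delta / 48]; [kappa] is the base of their
   cardinality. *)
pose k := (Num.bound (144 / delta)).+1; pose kappa : R := (2 * k.+1)%:R.
(* Rate of the concentration bound at [t = delta / 8], the distortion allowed on the net. *)
pose c : R := (delta / 8) ^+ 2 / (4 * chi_const R).
have chi8 := chi_const_ge8 R.
have c0 : 0 < c by rewrite /c divr_gt0 ?exprn_gt0 ?divr_gt0 ?mulr_gt0//; lra.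
have kappa1 : 1 <= kappa by rewrite ler1n.
have rho0 : 0 <= 3 / k%:R :> R by rewrite divr_ge0.
have k0 : 0 < k%:R :> R by rewrite ltr0n.
have rho_le : 3 / k%:R <= delta / 48.
  have h : 144 / delta <= k%:R.
    apply: le_trans (ler_norm _) _; apply: le_trans (ltW (unstable.ltr_norm_bound _)) _.
    by rewrite ler_nat leqnSn.
  by move: h; rewrite ler_pdivrMr// => h; rewrite ler_pdivrMr//; lra.
exists ((ln kappa + 1) / c); split.
  by rewrite divr_gt0// ltr_wpDl// ln_ge0.
move=> n N m r eps d T P X r1 rn e0 e1 [omega [indep normal XE]] hm good.
have XmE w A : X w A = meas_map (gauss_mx omega w) A.
  by rewrite XE; apply/rowP => j; rewrite !mxE.
pose nu w (A : 'M[R]_(n, N)) := l2_norm (meas_map (gauss_mx omega w) A).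
have nu_ge0 w A : 0 <= nu w A by exact: sqrtr_ge0.
have nuD w : forall A B, nu w (A + B) <= nu w A + nu w B.
  by move=> A B; exact: meas_map_normD.
have nuZ w : forall a A, nu w (a *: A) = `|a| * nu w A.
  by move=> a A; exact: meas_map_normZ.
have nuK w := meas_map_bounded (gauss_mx omega w).
have nuK0 w := meas_map_bound_ge0 (gauss_mx omega w).
(* The clause on [rank_ric] follows from the isometry inequalities, since [delta] is then admissible
   in the infimum. *)
have goodE : good = [set w | forall A, (\rank A <= r)%N -> near_isometric (nu w) delta A].
  apply/seteqP; split=> [w [_ h] A rA|w h].
    by have := h A rA; rewrite XmE.
  have rip : rank_rip r (X w) delta by move=> A rA; rewrite XmE; exact: h.
  by split=> //; apply: rank_ric_le => //; exact: ltW.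
have mgood : measurable good.
  rewrite goodE (_ : [set w | _] =
      \bigcap_(Z : 'M[int]_(n, r) * 'M[int]_(r, N))
        near_iso_event omega delta (rmx R Z.1 *m rmx R Z.2)); last first.
    apply/seteqP; split=> [w h Z _|w h A rA].
      by apply: h; exact: rank_mulmx_le.
    apply: (near_isometric_of_lattice (r := r) (nu_ge0 w) (nuD w) (nuZ w) (nuK0 w) (nuK w)
      (ltW delta_gt0) (ltW delta_lt1)) => // Z1 Z2.
    exact: (h (Z1, Z2) Logic.I).
  by apply: countable_bigcap_measurable => Z; exact: measurable_near_iso_event.
split=> //.
(* The nets are chosen independently of the sample [w], as the union bound requires. *)
have [SV [szV netV]] : exists SV : seq 'M[R]_(n, r),
    (size SV <= (2 * k.+1) ^ (n * r))%N /\ forall V, frob_norm V <= 1 ->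
    exists2 V', V' \in SV & frob_norm (V - V') <= 3 / k%:R.
  apply: (@norm_net R n r (fun t V => frob_norm V <= t) _ _ _ _ (n * r)%:R) => //.
  - move=> s t A B hA hB; apply: le_trans (frob_normD _ _) _; exact: lerD.
  - by move=> a t A hA; rewrite frob_normZ ler_wpM2l.
  - by move=> t A i j; apply: le_trans; exact: entry_le_frob_norm.
  - by move=> s t A st sA; exact: le_trans st.
  - by move=> h A; exact: frob_norm_of_entries.
have [SU [szU netU]] : exists SU : seq 'M[R]_(r, N),
    (size SU <= (2 * k.+1) ^ (r * N))%N /\ forall U, op_ball 1 U ->
    exists2 U', U' \in SU & op_ball (3 / k%:R) (U - U').
  apply: (@norm_net R r N (@op_ball R r N) _ _ _ _ (r * N)%:R) => //.
  - by move=> s t A B; exact: op_ballD.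
  - by move=> a t A; exact: op_ballZ.
  - by move=> t A i j; exact: op_ball_entry.
  - by move=> s t A; exact: le_op_ball.
  - by move=> h A; exact: op_ball_of_entries.
(* [eps < 1] makes [ln (2 / eps)] positive, which excludes [m = 0]. *)
have m0 : (0 < m)%N.
  rewrite -(ltr0n R); apply: lt_le_trans hm.
  rewrite mulr_gt0//; first by rewrite divr_gt0// ltr_wpDl// ln_ge0.
  have l0 : 0 < ln (2 / eps) by rewrite ln_gt0// ltr_pdivlMr//; lra.
  by apply: ltr_wpDl l0; rewrite mulr_ge0// addr_ge0.
pose bad (p : 'M[R]_(n, r) * 'M[R]_(r, N)) :=
  ~` near_iso_event omega (delta / 8) (p.1 *m p.2).
have mbad p : measurable (bad p).
  by apply: measurableC; exact: measurable_near_iso_event.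
have d8 : 0 < delta / 8 by lra.
have d81 : delta / 8 <= 1 by lra.
pose S := [seq (V, U) | V <- SV, U <- SU].
have [mbads hbads] := union_bound mbad (fun p (_ : p \in S) =>
  near_iso_event_concentration indep normal (p.1 *m p.2) m0 d8 d81).
have szS : (size S)%:R <= kappa ^+ (n * r + r * N).
  by rewrite size_allpairs -natrX ler_nat expnD leq_mul.
have subgood : ~` good `<=` [set w | exists2 p, p \in S & bad p w].
  move=> w; rewrite goodE => ngood; apply: contra_notP ngood => nbad A rA.
  apply: (rip_of_net (nu_ge0 w) (nuD w) (nuZ w) (nuK w) rho0 _ netV netU) => //.
    by apply: le_trans rho_le _; lra.
  move=> V U SVV SUU; apply: contrapT => nVU; apply: nbad.
  by exists (V, U) => //; exact: allpairs_f.
have PC : (P (~` good) <= eps%:E)%E.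
  apply: (@le_trans _ _ (P [set w | exists2 p, p \in S & bad p w])).
    by apply: le_measure; rewrite ?inE//; exact: measurableC.
  apply: le_trans hbads _; rewrite lee_fin.
  apply: (net_cardinality_bound kappa1 c0 e0 e1 _ szS).
  apply: le_trans hm; rewrite mulnC -mulnDr natrM natrD.
  by [].
rewrite -[good]setCK probability_setC; last exact: measurableC.
by rewrite EFinB leeB.
Qed.
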